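(* Let $k$ be a positive integer, let $V_k$ be a $k$-dimensional vector space over $K$ with a non-degenerate symmetric bilinear form $\langle\ ,\ \rangle$, and let $C_k$ be the Clifford algebra of $V_k$. Then the weak polynomial identities of the pair $(C_k,V_k)$ are $GL$-consequences of the polynomial $[x_1^2,x_2]$ and of the standard polynomial $$S_{k+1}(x_1,\ldots,x_{k+1})=\sum_{\sigma}(-1)^{\sigma}x_{\sigma(1)}\cdots x_{\sigma(k+1)},$$ where $\sigma$ runs over all permutations of $\{1,\ldots,k+1\}$ and $(-1)^\sigma$ is the sign of $\sigma$.
   Context: $K$ is a fixed field of characteristic $0$. $K\langle X\rangle$ is the free associative algebra over $K$ on $X=\{x_1,x_2,\ldots\}$, and $\mathrm{sp}(X)$ is the vector subspace of $K\langle X\rangle$ spanned by $X$. $[a,b]=ab-ba$. The Clifford algebra $C_k$ of $V_k$ is the associative algebra generated by $V_k$ with $v^2=\langle v,v\rangle\in K$ for all $v\in V_k$. Let $R$ be an associative algebra and $G$ a vector subspace of $R$ generating $R$ as an algebra. A polynomial $f(x_1,\ldots,x_n)\in K\langle X\rangle$ is a weak (polynomial) identity of the pair $(R,G)$ if $f(g_1,\ldots,g_n)=0$ for all $g_1,\ldots,g_n\in G$. For a subset $H=\{h_i(x_1,\ldots,x_{n_i})\mid i\in I\}$ of $K\langle X\rangle$, the $GL$-ideal generated by $H$ is the two-sided ideal of $K\langle X\rangle$ generated by all $h_i(\omega_1,\ldots,\omega_{n_i})$ with $i\in I$ and $\omega_j\in\mathrm{sp}(X)$. Its elements are called $GL$-consequences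 of $H$. *)

(* Defs.v *)
(* MathComp; free monoid algebras come from multinomials' monalg. *)
From HB Require Import structures.
From mathcomp Require Import all_boot all_order all_fingroup all_algebra.
From mathcomp.multinomials Require Import monalg.

Set Implicit Arguments.
Unset Strict Implicit.
Unset Printing Implicit Defensive.

Import GRing.Theory.
Local Open Scope ring_scope.

(* K<X> with unit, as the algebra of the free monoid on nat; the index i
   stands for the variable x_(i+1). *)
Notation free_alg K := {malg K[{fmonom nat}]}.

Definition fvar (K : fieldType) (i : nat) : free_alg K := << fmu i >>.

(* f(g_1, g_2, ...): the K-linear map sending the word x_i1 ... x_id to
   g_i1 * ... * g_id. It is stated over lalgType because monalg equips
   {malg K[_]} with no more than that. *)
Definition feval (K : fieldType) (R : lalgType K) (g : nat -> R)
    (f : free_alg K) : R :=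
  mmap (in_alg R) (fun w : {fmonom nat} => \prod_(i <- w) g i) f.

(* Meant for pairs (R, G) where G is a vector subspace generating R. *)
Definition weak_identity (K : fieldType) (R : algType K) (G : R -> Prop)
    (f : free_alg K) : Prop :=
  forall g : nat -> R, (forall i, G (g i)) -> feval g f = 0.

Definition in_spX (K : fieldType) (w : free_alg K) : Prop :=
  exists (n : nat) (c : nat -> K), w = \sum_(i < n) c i *: fvar K i.

(* Closure under opposites follows from left multiplication by -1. *)
Record two_sided_ideal (A : pzRingType) (J : A -> Prop) : Prop := {
  tsi0 : J 0;
  tsiD : forall a b, J a -> J b -> J (a + b);
  tsiMl : forall a b, J b -> J (a * b);
  tsiMr : forall a b, J a -> J (a * b)
}.

Definition ideal_generated (A : pzRingType) (S : A -> Prop) (a : A) : Prop :=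
  forall J : A -> Prop,
    two_sided_ideal J -> (forall s, S s -> J s) -> J a.

Definition GL_ideal (K : fieldType) (H : free_alg K -> Prop) :
    free_alg K -> Prop :=
  ideal_generated (fun p : free_alg K =>
    exists (h : free_alg K) (w : nat -> free_alg K),
      [/\ H h, forall j, in_spX (w j) & p = feval w h]).

Definition lie_bracket (A : pzRingType) (a b : A) : A := a * b - b * a.

Definition std_poly (K : fieldType) (m : nat) : free_alg K :=
  \sum_(s : 'S_m) (-1) ^+ s *: \prod_(i < m) fvar K (s i).

(* (C, iota) is the algebra generated by V subject to the linear relations of V
   and v^2 = b(v, v), expressed by its universal property, which determines it
   up to a unique isomorphism compatible with iota. MathComp's algType excludes
   only the zero algebra, into which every algebra has exactly one map. *)
Record is_clifford (K : fieldType) (V : lmodType K) (b : V -> V -> K)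
    (C : algType K) (iota : {linear V -> C}) : Prop := {
  clifford_sqr : forall v, iota v ^+ 2 = (b v v)%:A;
  clifford_univ : forall (A : algType K) (phi : {linear V -> A}),
    (forall v, phi v ^+ 2 = (b v v)%:A) ->
    exists psi : {lrmorphism C -> A},
      (forall v, psi (iota v) = phi v) /\
      (forall psi' : {lrmorphism C -> A},
         (forall v, psi' (iota v) = phi v) -> psi' =1 psi)
}.

(* Main.v *)
Require Import Defs.
From HB Require Import structures.
From mathcomp Require Import all_boot all_order all_fingroup all_algebra.
From mathcomp Require Import finmap zify.
From mathcomp.multinomials Require Import monalg.
From Stdlib Require Import Setoid Morphisms.

Set Implicit Arguments.
Unset Strict Implicit.
Unset Printing Implicit Defensive.

Import GRing.Theory.
Local Open Scope ring_scope.

(** Fix a two-sided ideal J of the free algebra containing the GL-consequences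
    of the two polynomials.  The linearization of [x_1^2, x_2] says that all
    anticommutators t(x, y) = xy + yx of variables are central modulo J, so
    that every multilinear polynomial of degree n is congruent to a combination
    of the products
      m_π = prod_{a < π a} t(z_a, z_(π a)) * prod_{π p = p} z_p   ([mword])
    over the involutions π of {0, ..., n-1}.  Compare involutions
    lexicographically, as functions.  Exchanging two letters of a word costs a
    sign and a term with one more 2-cycle, which is lexicographically larger
    ([mword_swap]), so the order of the fixed letters does not matter up to
    sign and larger terms.

    The standard polynomial removes more of these products.  Multiplying
    S_m(x_1, ..., x_m) by y on the left and on the right and combining the two
    with the right sign gives m times the alternating sum of the
    t(y, x_i) S_(m-1)(..., no x_i, ...) ([mul_std], [mul_paired_std]).  Hence J
    contains all alternating sums over k+1 letters, some of which are paired by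
    t with other letters and the rest of which are multiplied
    ([paired_std_ideal]).  If both i and π i increase along some chain of k+1
    indices i, such a sum has m_π as its smallest term, so m_π is congruent to
    a combination of larger ones ([chain_span]).  There remain the π all of
    whose chains have length at most k ([short_chains_span]).

    For those π the products are linearly independent on V_k.  Let the height
    of i be the length of the longest chain strictly below i; it takes at most
    k values, and π preserves it because reversing the roles of i and π i maps
    chains to chains.  Substitute for z_i the vector e_(height i) of an
    orthogonal basis.  Then m_π takes an invertible value, whereas m_κ
    vanishes unless κ preserves the heights; on each level π is decreasing, so
    that every such κ is at most π ([heights_rigid]).  This triangularity forces
    all coefficients of a weak identity to be zero
    ([short_chains_independent]).  The congruences in the free algebra and the
    equalities in C_k must hold with the same coefficients; they are therefore
    established at once for a family of algebras ([Span]).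

    It remains to reduce to multilinear polynomials.  If f is a weak identity
    with words of length at most n, inclusion-exclusion over sums of disjoint
    blocks of vectors extracts from f the sums over all rearrangements of a
    word of length n ([polarization]).  Substituting variables back and adding
    over all words returns n! times the component of degree n of f, which thus
    lies in J and is a weak identity; induction on n concludes
    ([weak_identity_ideal]). *)

(** * Alternating sums over a sequence *)

Lemma perm_insert (T : eqType) (x y : T) q r :
  perm_eq (y :: q) r -> perm_eq (y :: x :: q) (x :: r).
Proof. by rewrite (perm_catCA [:: y] [:: x]) perm_cons. Qed.

(** This is the sum of (-1)^j F s_j (s minus s_j) over the positions j of s,
    as shown by [apickE].  The recursion on s makes the sign rules below
    provable without any arithmetic on positions. *)
Fixpoint apick (A : zmodType) (T : Type) (F : T -> seq T -> A) (s : seq T) : A :=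
  if s is x :: r then F x r - apick (fun y q => F y (x :: q)) r else 0.

Lemma eq_apick (A : zmodType) (T : eqType) (F G : T -> seq T -> A) s :
  (forall y q, perm_eq (y :: q) s -> F y q = G y q) -> apick F s = apick G s.
Proof.
elim: s F G => //= x r IH F G FG; rewrite FG //; congr (_ - _).
apply: IH => y q yq; exact/FG/perm_insert.
Qed.

Lemma apickB (A : zmodType) (T : Type) (F G : T -> seq T -> A) s :
  apick (fun y q => F y q - G y q) s = apick F s - apick G s.
Proof.
by elim: s F G => [|x r IH] F G /=; rewrite ?subrr // IH !opprD addrACA.
Qed.

Lemma apick0 (A : zmodType) (T : Type) s :
  apick (fun (_ : T) (_ : seq T) => 0 : A) s = 0.
Proof. by elim: s => //= x r ->; rewrite subrr. Qed.

Lemma apickN (A : zmodType) (T : Type) (F : T -> seq T -> A) s :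
  apick (fun y q => - F y q) s = - apick F s.
Proof.
have := apickB (fun _ _ => 0) F s; rewrite apick0 sub0r => <-.
by elim: s F => //= x r IH F; rewrite sub0r IH.
Qed.

Lemma apickD (A : zmodType) (T : Type) (F G : T -> seq T -> A) s :
  apick (fun y q => F y q + G y q) s = apick F s + apick G s.
Proof.
rewrite -[in RHS](opprK (apick G s)) -apickN -apickB.
by elim: s F G => //= x r IH F G; rewrite opprK IH.
Qed.

(** Deleting entry i and then entry j, or j and then i, leaves the same
    sequence but with opposite signs, since the deletion of the earlier entry
    shifts the position of the later one. *)
Lemma apick_swap (A : zmodType) (T : Type) (G : T -> T -> seq T -> A) s :
  apick (fun x => apick (G x)) s = - apick (fun x => apick (fun y => G y x)) s.
Proof.
elim: s G => [|x r IH] G /=; first by rewrite oppr0.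
rewrite (apickB (fun y q => G y x q) (fun y q => apick (fun z p => G y z (x :: p)) q)).
rewrite (apickB (fun y q => G x y q) (fun y q => apick (fun z p => G z y (x :: p)) q)).
rewrite (IH (fun y z p => G y z (x :: p))).
set a := apick (G x) r; set b := apick _ r; set c := apick _ r.
by rewrite !opprB addrA.
Qed.


(** * Congruence modulo an ideal *)

Definition eqmod (A : pzRingType) (J : A -> Prop) (a b : A) : Prop := J (a - b).

Section Congruence.
Variables (K : fieldType) (B : lalgType K) (J : B -> Prop).
Hypothesis idealJ : two_sided_ideal J.
Local Notation "a ≡ b" := (eqmod J a b) (at level 70).

Lemma idealN a : J a -> J (- a).
Proof. by move=> Ja; rewrite -mulN1r; apply: tsiMl. Qed.

Lemma idealZ (c : K) a : J a -> J (c *: a).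
Proof. by move=> Ja; rewrite -mulr_algl; apply: tsiMl. Qed.

Lemma idealB a b : J a -> J b -> J (a - b).
Proof. by move=> Ja Jb; apply: tsiD => //; apply: idealN. Qed.

Lemma eqmod_equiv : Equivalence (eqmod J).
Proof.
split=> [a|a b ab|a b c ab bc]; rewrite /eqmod.
- by rewrite subrr; apply: tsi0.
- by rewrite -opprB; apply: idealN.
- by rewrite -[a](subrK b) -addrA; apply: tsiD.
Qed.

Lemma eqmod0 a : a ≡ 0 <-> J a.
Proof. by rewrite /eqmod subr0. Qed.

#[local] Existing Instance eqmod_equiv.

Lemma eqmod_refl a : a ≡ a.
Proof. by reflexivity. Qed.
#[local] Hint Resolve eqmod_refl : core.

#[local] Instance eqmod_add : Proper (eqmod J ==> eqmod J ==> eqmod J) +%R.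
Proof. by move=> a a' aa' b b' bb'; rewrite /eqmod opprD addrACA; apply: tsiD. Qed.

#[local] Instance eqmod_opp : Proper (eqmod J ==> eqmod J) -%R.
Proof. by move=> a a' aa'; rewrite /eqmod -opprD; apply: idealN. Qed.

#[local] Instance eqmod_mul : Proper (eqmod J ==> eqmod J ==> eqmod J) *%R.
Proof.
move=> a a' aa' b b' bb'; rewrite /eqmod -[a * b](subrK (a' * b)) -addrA.
rewrite -mulrBl -mulrBr; apply: (tsiD idealJ).
  exact: (tsiMr idealJ).
exact: (tsiMl idealJ).
Qed.

Lemma eqmodMn n a b : a ≡ b -> a *+ n ≡ b *+ n.
Proof.
move=> ab; elim: n => [|n IH]; first by rewrite !mulr0n.
by rewrite !mulrS; apply: eqmod_add.
Qed.

Lemma ideal_apick (T : eqType) (F : T -> seq T -> B) s :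
  (forall y q, perm_eq (y :: q) s -> J (F y q)) -> J (apick F s).
Proof.
elim: s F => [|x r IH] F FJ /=; first exact: tsi0.
apply: idealB; first exact: FJ.
apply: IH => y q yq; exact/FJ/perm_insert.
Qed.

Lemma eqmod_apick (T : eqType) (F G : T -> seq T -> B) s :
  (forall y q, perm_eq (y :: q) s -> F y q ≡ G y q) -> apick F s ≡ apick G s.
Proof. by move=> FG; rewrite /eqmod -apickB; apply: ideal_apick. Qed.

(** The factors commute only modulo J, so that the laws of products over
    commutative operators do not apply to them. *)
Lemma prod_perm_mod (T : eqType) (F : T -> B) s1 s2 :
  (forall x y, F x * F y ≡ F y * F x) -> perm_eq s1 s2 ->
  \prod_(x <- s1) F x ≡ \prod_(x <- s2) F x.
Proof.
move=> cF; elim: s1 s2 => [|x s1 IH] s2.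
  by rewrite perm_sym => /perm_nilP->.
move=> p; have xs2 : x \in s2 by rewrite -(perm_mem p) mem_head.
case/splitPr: xs2 p => u v p.
have {}p : perm_eq s1 (u ++ v).
  by rewrite -(perm_cons x) (perm_trans p) // (perm_catCA u [:: x]).
rewrite big_cons (IH _ p) !big_cat big_cons /= !mulrA.
suff -> : F x * (\prod_(i <- u) F i) ≡ (\prod_(i <- u) F i) * F x by [].
elim: {p} u => [|y u IHu]; first by rewrite !big_nil mulr1 mul1r.
by rewrite !big_cons mulrA cF -!mulrA IHu.
Qed.

(** * Standard polynomials with some letters paired *)

Section AlternatingSums.
Variables (T : eqType) (z : T -> B).

Definition anticomm x y : B := z x * z y + z y * z x.

Hypothesis comm_mod : forall x y l, anticomm x y * z l ≡ z l * anticomm x y.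

Lemma anticommC x y : anticomm x y = anticomm y x.
Proof. by rewrite /anticomm addrC. Qed.

Lemma anticomm_word x y (u : seq T) :
  anticomm x y * \prod_(p <- u) z p ≡ (\prod_(p <- u) z p) * anticomm x y.
Proof.
elim: u => [|l u IH]; first by rewrite !big_nil mulr1 mul1r.
by rewrite !big_cons mulrA comm_mod -!mulrA IH.
Qed.

Lemma anticomm_comm x y x' y' :
  anticomm x y * anticomm x' y' ≡ anticomm x' y' * anticomm x y.
Proof.
have := comm_mod x y; move: (anticomm x y) => a ca.
by rewrite /anticomm mulrDl mulrDr !mulrA !ca -!mulrA !ca.
Qed.

(** The standard polynomial in the letters of s when n is the size of s,
    expanded along its first factor; [stdE] is the sum over permutations. *)
Fixpoint std n (s : seq T) : B :=
  if n is n'.+1 then apick (fun y r => z y * std n' r) s else 1.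

(** The alternating sum over s in which the first chosen letters are
    anticommuted with the letters of ys and the others are multiplied.  It is
    what the products of S_m with the letters of ys yield modulo J. *)
Fixpoint paired_std (ys s : seq T) : B :=
  if ys is y :: ys' then apick (fun x r => anticomm y x * paired_std ys' r) s
  else std (size s) s.

Lemma apickMl a (F : T -> seq T -> B) s :
  a * apick F s = apick (fun y q => a * F y q) s.
Proof. by elim: s F => [|x r IH] F /=; rewrite ?mulr0 // mulrBr IH. Qed.

Lemma apickMr a (F : T -> seq T -> B) s :
  apick F s * a = apick (fun y q => F y q * a) s.
Proof. by elim: s F => [|x r IH] F /=; rewrite ?mul0r // mulrBl IH. Qed.

Lemma apickMn n (F : T -> seq T -> B) s :
  apick F s *+ n = apick (fun y q => F y q *+ n) s.
Proof. by elim: s F => [|x r IH] F /=; rewrite ?mul0rn // mulrnBl IH. Qed.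

Lemma perm_cons_size (y : T) q s : perm_eq (y :: q) s -> size s = (size q).+1.
Proof. by move/perm_size <-. Qed.

(** Move y through every word of the standard polynomial.  Passing the first
    letter x creates t(y, x), which is wanted; passing the later letters, by
    induction, creates the terms x t(y, l) with the letters x and l picked in the
    opposite order, which by [apick_swap] and centrality are again the wanted
    ones.  So each of the m letters contributes the same sum. *)
Lemma mul_std y s :
  z y * std (size s) s ≡
  (-1) ^+ size s * (std (size s) s * z y)
  + apick (fun x r => anticomm y x * std (size r) r) s *+ size s.
Proof.
elim: {s}(size s) {-2}s (erefl (size s)) => [|m IH] s.
  by move/size0nil->; rewrite /= mulr1 !mul1r mulr0n addr0.
move=> szs; rewrite szs /=.
have szq (x : T) q : perm_eq (x :: q) s -> size q = m.
  by move/perm_cons_size; rewrite szs => -[].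
set D := fun q : seq T => apick (fun l p => anticomm y l * std (size p) p) q.
have step : z y * apick (fun x r => z x * std m r) s ≡
    apick (fun x r => anticomm y x * std (size r) r) s
    - apick (fun x r => z x * ((-1) ^+ m * (std m r * z y) + D r *+ m)) s.
  rewrite apickMl -apickB; apply: eqmod_apick => x q /szq sq.
  rewrite mulrA -[z y * z x](addrK (z x * z y)) -/(anticomm y x) mulrBl.
  by rewrite sq -mulrA; have := IH q sq; rewrite sq => ->.
rewrite step.
have -> : apick (fun x r => z x * ((-1) ^+ m * (std m r * z y) + D r *+ m)) s =
   (-1) ^+ m * (apick (fun x r => z x * std m r) s * z y)
   + apick (fun x r => z x * D r) s *+ m.
  rewrite apickMr apickMl apickMn -apickD; apply: eq_apick => x q _.
  by rewrite mulrDr mulrnAr !mulrA -(commr_sign (z x)).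
have -> : apick (fun x r => z x * D r) s *+ m ≡
   - apick (fun x r => anticomm y x * std (size r) r) s *+ m.
  (* For m = 0 the left over sequence is empty and its std is 1, not an empty
     sum; the multiplicity m then removes both sides. *)
  case: m szq {IH szs step} => [_|m szq]; first by rewrite !mulr0n.
  apply: eqmodMn.
  have -> : apick (fun x r => z x * D r) s ≡
    apick (fun x => apick (fun l p => z x * (anticomm y l * std (size p) p))) s.
    by apply: eqmod_apick => x q _; rewrite apickMl.
  rewrite apick_swap; apply: eqmod_opp; apply: eqmod_apick => x q /szq sq.
  rewrite sq /= apickMl; apply: eqmod_apick => l p /perm_cons_size.
  by rewrite sq => -[<-]; rewrite !mulrA comm_mod.
by rewrite exprS mulN1r mulNr mulNrn opprD opprK mulrS addrCA.
Qed.

Lemma mul_paired_std y ys s :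
  z y * paired_std ys s ≡
  (-1) ^+ (size s - size ys) * (paired_std ys s * z y)
  + paired_std (rcons ys y) s *+ (size s - size ys).
Proof.
elim: ys s => [|y1 ys IH] s; first by rewrite subn0; apply: mul_std.
rewrite /= apickMl apickMr apickMl apickMn -apickD.
apply: eqmod_apick => x q /perm_cons_size ->; rewrite subSS.
rewrite mulrA -comm_mod -mulrA IH mulrDr mulrnAr !mulrA.
by rewrite -(commr_sign (anticomm y1 x)).
Qed.

Lemma paired_std_oversize ys s : (size s < size ys)%N -> paired_std ys s = 0.
Proof.
elim: ys s => //= y ys IH s lts; rewrite -[RHS](apick0 _ s).
apply: eq_apick => x q /perm_cons_size szs.
by rewrite IH ?mulr0 // -ltnS -szs.
Qed.

Lemma std_ideal N s : (forall s, size s = N -> J (std N s)) ->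
  (N <= size s)%N -> J (std (size s) s).
Proof.
move=> stdN; move: {2}(size s) (erefl (size s)) => m.
elim: m s => [|m IH] s szs; rewrite szs.
  by rewrite leqn0 => /eqP N0; rewrite -N0; apply: stdN; rewrite szs.
rewrite leq_eqVlt => /orP[/eqP N1|leN]; first by rewrite -N1; apply: stdN; lia.
rewrite /=; apply: ideal_apick => y q /perm_cons_size; rewrite szs => -[sq].
by apply: (tsiMl idealJ); rewrite sq; apply: IH; rewrite -sq.
Qed.

(** By [mul_paired_std], the sum with one more paired letter is, up to the
    number of unpaired letters, a combination of one-sided multiples of the
    previous one.  That number is invertible in characteristic 0, and if it is
    zero the sum is empty. *)
Lemma paired_std_ideal N ys s : [pchar K] =i pred0 ->
  (forall s, size s = N -> J (std N s)) -> (N <= size s)%N -> J (paired_std ys s).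
Proof.
move=> charK0 stdN leN; elim/last_ind: ys => [|ys y IH].
  exact: std_ideal stdN _.
have [le_s|lt_s] := leqP (size s) (size ys).
  by rewrite paired_std_oversize ?size_rcons //; apply: tsi0.
have m_neq0 : (size s - size ys)%:R != 0 :> K.
  by rewrite ((pcharf0P K).1 charK0) subn_eq0 -ltnNge.
rewrite -[paired_std _ _]scale1r -(mulVf m_neq0) -scalerA; apply: idealZ.
rewrite scaler_nat; apply/eqmod0.
have ysJ : paired_std ys s ≡ 0 by apply/eqmod0.
by have := mul_paired_std y ys s; rewrite ysJ mul0r !mulr0 add0r => <-.
Qed.

End AlternatingSums.
End Congruence.

Section StandardPolynomial.
Variables (B : pzRingType).

Lemma apickE (T : Type) (x0 : T) (F : T -> seq T -> B) s :
  apick F s =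
  \sum_(j < size s) (-1) ^+ j * F (nth x0 s j) (take j s ++ drop j.+1 s).
Proof.
elim: s F => [|x r IH] F; first by rewrite big_ord0.
rewrite /= big_ord_recl /= mul1r drop0 IH -sumrN; congr (_ + _).
by apply: eq_bigr => j _; rewrite exprS mulN1r mulNr.
Qed.

(** A permutation of m+1 letters amounts to its value at 0 and a permutation of
    the m other letters; it suffices to check injectivity and to count. *)
Lemma lift_perm_bij m :
  bijective (fun p : 'I_m.+1 * 'S_m => lift_perm ord0 p.1 p.2).
Proof.
apply: inj_card_bij => [[j s] [k t] /= e|]; last first.
  by rewrite card_prod card_Sn card_ord card_Sn factS.
have jk : j = k by rewrite -(lift_perm_id ord0 j s) e lift_perm_id.
rewrite -jk in e *; congr (_, _); apply/permP => i.
by apply: (@lift_inj _ j); rewrite -!(lift_perm_lift ord0) e.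
Qed.

End StandardPolynomial.

Lemma stdE (K : fieldType) (B : lalgType K) (T : eqType) (x0 : T) (z : T -> B) s :
  std z (size s) s =
  \sum_(t : 'S_(size s)) (-1) ^+ t * \prod_i z (nth x0 s (t i)).
Proof.
move: {-1}(size s) (erefl (size s)) => m; elim: m s => [|m IH] s szs.
  rewrite (bigD1 1%g) //= odd_perm1 mul1r big_ord0 big1 ?addr0 // => t.
  by case/eqP; apply/permP => -[].
rewrite /= (apickE x0) szs (reindex _ (onW_bij _ (lift_perm_bij m))) /=.
rewrite -(pair_bigA _ (fun j t => (-1) ^+ lift_perm ord0 j t *
  \prod_i z (nth x0 s (lift_perm ord0 j t i)))) /=.
apply: eq_bigr => j _.
have szj : size (take j s ++ drop j.+1 s) = m.
  by rewrite size_cat size_take size_drop szs ltn_ord; have := ltn_ord j; lia.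
rewrite (IH _ szj) !mulr_sumr; apply: eq_bigr => t _.
rewrite odd_lift_perm /= signr_addb signr_odd big_ord_recl lift_perm_id.
rewrite -!mulrA (mulrA (z _)) (commr_sign (z _)) -!mulrA; congr (_ * (_ * (_ * _))).
apply: eq_bigr => i _; congr (z _); rewrite lift_perm_lift nth_cat size_take szs.
rewrite ltn_ord /= /bump; case: ltnP => ij; first by rewrite nth_take.
by rewrite nth_drop; congr nth; rewrite /= add1n addSn subnKC.
Qed.

(** Composition with the transposition of the two equal letters changes the
    sign of every term and preserves the words. *)
Lemma std_collision (K : fieldType) (B : lalgType K) (T : eqType) (x0 : T)
    (z : T -> B) (s : seq T) (a b : 'I_(size s)) :
  2%:R != 0 :> K -> a != b -> z (nth x0 s a) = z (nth x0 s b) ->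
  std z (size s) s = 0.
Proof.
move=> char2 ab zab; set X := std _ _ _.
have XN : X = - X.
  rewrite {1}/X (stdE x0) (reindex_inj (mulIg (tperm a b))) /X (stdE x0) -sumrN.
  apply: eq_bigr => t _; rewrite odd_permM odd_tperm ab addbT signrN mulNr.
  congr (- (_ * _)); apply: eq_bigr => i _; rewrite permM.
  by case: tpermP => // ->.
have : (2%:R : K) *: X = 0 by rewrite scaler_nat mulr2n {1}XN addNr.
by move/eqP; rewrite scaler_eq0 (negPf char2) => /eqP.
Qed.

Lemma std_pigeonhole (K : fieldType) (B : lalgType K) (T : eqType) k
    (c : T -> 'I_k) (e : 'I_k -> B) (s : seq T) :
  2%:R != 0 :> K -> (k < size s)%N -> std (e \o c) (size s) s = 0.
Proof.
move=> char2 ks; case: s ks => // x0 r; set s := x0 :: r => ks.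
have /injectivePn[a [b ab cab]] : ~~ injectiveb (fun i : 'I_(size s) => c (nth x0 s i)).
  apply/injectiveP => inj; have := leq_card _ inj; rewrite !card_ord => le_sk.
  by move: ks; rewrite ltnNge le_sk.
by apply: (std_collision (x0 := x0) char2 ab) => /=; rewrite cab.
Qed.

(** * Involutions ordered lexicographically *)

Section Matchings.
Variable n : nat.
Local Notation mate := {ffun 'I_n -> 'I_n}.

(** For fixed points p and q of an involution this adds the 2-cycle (p q). *)
Definition rematch (π : mate) (p q : 'I_n) : mate :=
  [ffun a => if a == p then q else if a == q then p else π a].

Definition fixpts (π : mate) : seq 'I_n := [seq p <- enum 'I_n | π p == p].

Definition ltmate (π κ : mate) : bool :=
  [exists d : 'I_n, [forall e : 'I_n, (e < d)%N ==> (π e == κ e)] && (π d < κ d)%N].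

Lemma ltmateP (π κ : mate) :
  reflect (exists2 d : 'I_n, (forall e : 'I_n, (e < d)%N -> π e = κ e) & (π d < κ d)%N)
    (ltmate π κ).
Proof.
apply: (iffP existsP) => [[d /andP[/forallP h hd]]|[d h hd]]; exists d => //.
  by move=> e ed; apply/eqP; apply: (implyP (h e)).
by rewrite hd andbT; apply/forallP => e; apply/implyP => /h/eqP.
Qed.

Lemma ltmate_irr (π : mate) : ltmate π π = false.
Proof. by apply/ltmateP => -[d _]; rewrite ltnn. Qed.

Lemma ltmate_trans (κ π ρ : mate) : ltmate π κ -> ltmate κ ρ -> ltmate π ρ.
Proof.
move=> /ltmateP[d hd ltd] /ltmateP[d' hd' ltd']; apply/ltmateP.
have [dd'|d'd|/val_inj dd'] := ltngtP d d'.
- exists d => [e ed|]; last by rewrite -hd'.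
  by rewrite hd // hd' // (ltn_trans ed).
- exists d' => [e ed|]; last by rewrite hd.
  by rewrite hd ?hd' // (ltn_trans ed).
- subst d'; exists d => [e ed|]; last exact: ltn_trans ltd ltd'.
  by rewrite hd ?hd'.
Qed.

Lemma first_diff (π κ : mate) : π != κ ->
  exists2 d : 'I_n, (forall e : 'I_n, (e < d)%N -> π e = κ e) & π d != κ d.
Proof.
move=> ne; have [d0 hd0] : exists d, π d != κ d.
  apply/existsP; apply: contraNT ne; rewrite negb_exists => /forallP h.
  by apply/eqP/ffunP => a; apply/eqP; rewrite -[_ == _]negbK.
case: (arg_minnP (P := fun d => π d != κ d) (fun d : 'I_n => d : nat) hd0) => d hd hmin.
exists d => // e ed; apply/eqP; rewrite -[_ == _]negbK; apply: contraL ed => /hmin.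
by rewrite -leqNgt.
Qed.

(** If π d were smaller than d, then κ would agree with π there, and so at d,
    as both are involutions. *)
Lemma first_diff_ge (π κ : mate) (d : 'I_n) : involutive π -> involutive κ ->
  (forall e : 'I_n, (e < d)%N -> π e = κ e) -> π d != κ d -> (d <= π d)%N.
Proof.
move=> iπ iκ h ne; rewrite leqNgt; apply: contra ne => lt.
by rewrite -{2}(iπ d) (h _ lt) iκ.
Qed.

Lemma ltmate_total (π κ : mate) : π != κ -> ltmate π κ \/ ltmate κ π.
Proof.
move=> /first_diff[d h]; rewrite -val_eqE neq_ltn => /orP[] lt; [left|right].
  by apply/ltmateP; exists d.
by apply/ltmateP; exists d => // e /h.
Qed.

Section Rematch.
Variables (π : mate) (p q : 'I_n).
Hypotheses (invπ : involutive π) (fixp : π p = p) (fixq : π q = q) (neq : p != q).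

Lemma rematchC : rematch π p q = rematch π q p.
Proof.
apply/ffunP => a; rewrite !ffunE; have [->|//] := eqVneq a p.
by rewrite (negPf neq).
Qed.

Lemma rematchl : rematch π p q p = q.
Proof. by rewrite ffunE eqxx. Qed.

Lemma rematchr : rematch π p q q = p.
Proof. by rewrite ffunE eqxx eq_sym (negPf neq). Qed.

Lemma rematchE a : a != p -> a != q -> rematch π p q a = π a.
Proof. by move=> /negPf ap /negPf aq; rewrite ffunE ap aq. Qed.

Lemma rematch_invol : involutive (rematch π p q).
Proof.
move=> a; have [->|ap] := eqVneq a p; first by rewrite rematchl rematchr.
have [->|aq] := eqVneq a q; first by rewrite rematchr rematchl.
rewrite (rematchE ap aq) rematchE //.
  by apply: contraNneq ap => h; rewrite -[a]invπ h fixp.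
by apply: contraNneq aq => h; rewrite -[a]invπ h fixq.
Qed.

End Rematch.

Lemma rematch_gt (π : mate) p q :
  π p = p -> π q = q -> p != q -> ltmate π (rematch π p q).
Proof.
wlog pq : p q / (p < q)%N.
  move=> th fixp fixq neq; move: (neq); rewrite -val_eqE neq_ltn => /orP[pq|qp].
    exact: th.
  by rewrite rematchC //; apply: th => //; rewrite eq_sym.
move=> fixp fixq neq; apply/ltmateP; exists p => [e ep|]; last first.
  by rewrite fixp ffunE eqxx.
rewrite ffunE -!val_eqE /=.
by rewrite (ltn_eqF ep) (ltn_eqF (ltn_trans ep pq)).
Qed.


Lemma mem_fixpts (π : mate) p : (p \in fixpts π) = (π p == p).
Proof. by rewrite mem_filter mem_enum andbT. Qed.

Lemma uniq_fixpts (π : mate) : uniq (fixpts π).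
Proof. by rewrite filter_uniq // enum_uniq. Qed.

Lemma fixpts_rematch (π : mate) p q u : involutive π -> p != q ->
  perm_eq (p :: q :: u) (fixpts π) -> perm_eq u (fixpts (rematch π p q)).
Proof.
move=> iπ neq pu; have : uniq (p :: q :: u) by rewrite (perm_uniq pu) uniq_fixpts.
rewrite /= inE negb_or -!andbA => /and4P[_ pnu qnu uu].
apply: uniq_perm => // [|a]; first exact: uniq_fixpts.
have := perm_mem pu a; rewrite !inE !mem_fixpts ffunE.
have [->|ap] := eqVneq a p; first by rewrite (negPf pnu) [q == p]eq_sym (negPf neq).
by have [->|aq] := eqVneq a q; first by rewrite (negPf qnu) (negPf neq).
Qed.

End Matchings.

(** * Products attached to an involution *)

Section MatchedWords.
Variables (K : fieldType) (B : lalgType K) (J : B -> Prop) (n : nat).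
Variable z : 'I_n -> B.
Hypothesis idealJ : two_sided_ideal J.
Hypothesis comm_mod :
  forall x y l : 'I_n, eqmod J (anticomm z x y * z l) (z l * anticomm z x y).
Local Notation "a ≡ b" := (eqmod J a b) (at level 70).
Local Notation mate := {ffun 'I_n -> 'I_n}.

#[local] Instance eqmod_equiv' : Equivalence (eqmod J) := eqmod_equiv idealJ.
#[local] Instance eqmod_add' : Proper (eqmod J ==> eqmod J ==> eqmod J) +%R :=
  eqmod_add idealJ.
#[local] Instance eqmod_mul' : Proper (eqmod J ==> eqmod J ==> eqmod J) *%R :=
  eqmod_mul idealJ.
Let eqmod_refl' a : a ≡ a := eqmod_refl idealJ a.
#[local] Hint Resolve eqmod_refl' : core.

Definition mate_prod (π : mate) : B :=
  \prod_(a : 'I_n | (a < π a)%N) anticomm z a (π a).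

(** The word u is a parameter, rather than the increasing list of the fixed
    points of π, so that unsorted words can be compared with the sorted one. *)
Definition mword (π : mate) (u : seq 'I_n) : B :=
  mate_prod π * \prod_(p <- u) z p.

Lemma anticomm_mate_prod p q π : anticomm z p q * mate_prod π ≡ mate_prod π * anticomm z p q.
Proof.
rewrite /mate_prod; elim: (index_enum _) => [|a s IH].
  by rewrite !big_nil mulr1 mul1r.
rewrite !big_cons; case: ifP => // _.
by rewrite mulrA (anticomm_comm idealJ comm_mod) -!mulrA IH.
Qed.

Lemma mate_prod_rematch (π : mate) p q :
  involutive π -> π p = p -> π q = q -> p != q ->
  anticomm z p q * mate_prod π ≡ mate_prod (rematch π p q).
Proof.
move=> iπ; wlog pq : p q / (p < q)%N.
  move=> th fixp fixq neq; move: (neq); rewrite -val_eqE neq_ltn => /orP[pq|qp].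
    exact: th.
  by rewrite rematchC // anticommC; apply: th => //; rewrite eq_sym.
move=> fixp fixq neq; set κ := rematch π p q.
rewrite /mate_prod -[X in _ ≡ X]big_filter; set r := index_enum _.
have -> : anticomm z p q * \prod_(a <- r | ((a : 'I_n) < π a)%N) anticomm z a (π a) =
   \prod_(a <- p :: [seq a <- r | ((a : 'I_n) < π a)%N]) anticomm z a (κ a).
  rewrite big_cons /κ rematchl -big_filter; congr (_ * _).
  apply: eq_big_seq => a; rewrite mem_filter => /andP[lta _].
  rewrite rematchE //; first by apply: contraTneq lta => ->; rewrite fixp ltnn.
  by apply: contraTneq lta => ->; rewrite fixq ltnn.
apply: prod_perm_mod => //.
  by move=> a b; apply: (anticomm_comm idealJ comm_mod).
apply: uniq_perm => [||a].
- by rewrite /= mem_filter fixp ltnn filter_uniq // index_enum_uniq.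
- by rewrite filter_uniq // index_enum_uniq.
rewrite inE !mem_filter mem_index_enum !andbT.
have [->|ap] := eqVneq a p; first by rewrite /κ rematchl pq.
have [->|aq] := eqVneq a q; last by rewrite /κ rematchE.
by rewrite /κ rematchr // fixq ltnn ltnNge ltnW.
Qed.

Lemma mate_prod_absorb (π : mate) p q a :
  involutive π -> π p = p -> π q = q -> p != q ->
  mate_prod π * (anticomm z p q * a) ≡ mate_prod (rematch π p q) * a.
Proof.
by move=> iπ fp fq neq; rewrite mulrA -anticomm_mate_prod mate_prod_rematch.
Qed.

(** The sum of two words differing by the exchange of adjacent letters contains
    an anticommutator, which is central and joins the others. *)
Lemma mword_swap (π : mate) u p q v :
  involutive π -> π p = p -> π q = q -> p != q ->
  mword π (u ++ p :: q :: v) + mword π (u ++ q :: p :: v) ≡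
  mword (rematch π p q) (u ++ v).
Proof.
move=> iπ fp fq neq; rewrite /mword -mulrDr !big_cat !big_cons /= -mulrDr.
rewrite [z q * (z p * _)]mulrA [z p * (z q * _)]mulrA -mulrDl -/(anticomm z p q).
rewrite [X in _ * X]mulrA -(anticomm_word idealJ comm_mod) -mulrA mulrA.
by rewrite -anticomm_mate_prod mate_prod_rematch.
Qed.

End MatchedWords.

(** * Combinations with the same coefficients in all algebras *)

Lemma perm_swap_ind (T : eqType) (Q : seq T -> Prop) :
  (forall u p q v, Q (u ++ p :: q :: v) -> Q (u ++ q :: p :: v)) ->
  forall s t, perm_eq s t -> Q s -> Q t.
Proof.
(* With a common prefix w, exchanges in the tails are exchanges in the whole
   sequences. *)
move=> Qswap s t; rewrite -[s]cat0s -[t]cat0s; move: [::] => w.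
rewrite perm_cat2l; elim: t w s => [|x t IH] w s.
  by move/perm_nilP->.
move=> p; have xs : x \in s by rewrite (perm_mem p) mem_head.
case/splitPr: xs p => u v; rewrite perm_sym -cat1s perm_sym.
rewrite (perm_catCA u [:: x] v) perm_cons => p Quv.
rewrite -cat_rcons; apply: (IH _ _ p); rewrite cat_rcons.
elim/last_ind: u v {p} Quv => // u y IHu v.
rewrite !cat_rcons => Quv; apply: IHu.
by move: Quv; rewrite !catA; apply: Qswap.
Qed.

Section Spans.
Variables (K : fieldType) (Idx : Type) (B : Idx -> lalgType K).
Variables (J : forall i, B i -> Prop) (n : nat) (z : forall i, 'I_n -> B i).
Arguments J : clear implicits.
Hypothesis charK0 : [pchar K] =i pred0.
Hypothesis idealJ : forall i, two_sided_ideal (J i).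
Hypothesis comm_mod : forall i (x y l : 'I_n),
  eqmod (J i) (anticomm (z i) x y * z i l) (z i l * anticomm (z i) x y).
Variable N : nat.
Hypothesis stdJ : forall i s, size s = N -> J i (std (z i) N s).
Local Notation mate := {ffun 'I_n -> 'I_n}.
Local Notation term := (forall i, B i).

(** The coefficients c do not depend on the index i.  The family will consist
    of the free algebra and of one copy of the Clifford algebra for each choice
    of basis vectors, so that coefficients found to be zero by evaluation are
    zero in the free algebra. *)
Definition Span (P : mate -> Prop) (X : term) : Prop :=
  exists c : mate -> K, (forall π, c π != 0 -> P π) /\
    forall i, eqmod (J i) (X i) (\sum_π c π *: mword (z i) π (fixpts π)).

Lemma Span_eqmod P (X Y : term) :
  (forall i, eqmod (J i) (X i) (Y i)) -> Span P Y -> Span P X.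
Proof.
move=> XY [c [Pc Yc]]; exists c; split=> // i.
by have := eqmod_equiv (idealJ i) => E; transitivity (Y i).
Qed.

Lemma Span_ideal P (X : term) : (forall i, J i (X i)) -> Span P X.
Proof.
move=> JX; exists (fun=> 0); split=> [π|i]; first by rewrite eqxx.
by rewrite big1 ?eqmod0 // => π _; rewrite scale0r.
Qed.

Lemma Span_mono (P Q : mate -> Prop) X :
  (forall π, P π -> Q π) -> Span P X -> Span Q X.
Proof. by move=> PQ [c [Pc Xc]]; exists c; split=> // π /Pc/PQ. Qed.

Lemma SpanB P (X Y : term) : Span P X -> Span P Y -> Span P (fun i => X i - Y i).
Proof.
move=> [c [Pc Xc]] [d [Pd Yd]]; exists (fun π => c π - d π); split=> [π|i].
  case: (eqVneq (c π) 0) => [->|/Pc //]; rewrite sub0r oppr_eq0; exact: Pd.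
under eq_bigr do rewrite scalerBl; rewrite sumrB /eqmod.
by rewrite opprD addrACA -opprD; apply: (idealB (idealJ i)); [apply: Xc|apply: Yd].
Qed.

Lemma SpanZ P (a : K) (X : term) : Span P X -> Span P (fun i => a *: X i).
Proof.
move=> [c [Pc Xc]]; exists (fun π => a * c π); split=> [π|i].
  by rewrite mulf_eq0 negb_or => /andP[_ /Pc].
under eq_bigr do rewrite -scalerA; rewrite -scaler_sumr /eqmod -scalerBr.
by apply: (idealZ (idealJ i)); apply: Xc.
Qed.

Lemma Span0 P : Span P (fun i => 0).
Proof. by apply: Span_ideal => i; apply: (tsi0 (idealJ i)). Qed.

Lemma SpanN P (X : term) : Span P X -> Span P (fun i => - X i).
Proof.
move=> /(SpanZ (-1)); apply: Span_eqmod => i; rewrite scaleN1r.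
exact: eqmod_refl.
Qed.

Lemma SpanD P (X Y : term) : Span P X -> Span P Y -> Span P (fun i => X i + Y i).
Proof.
move=> PX /SpanN PY; have := SpanB PX PY; apply: Span_eqmod => i.
by rewrite opprK; apply: eqmod_refl.
Qed.

Lemma SpanMn P m (X : term) : Span P X -> Span P (fun i => X i *+ m).
Proof.
move=> /(SpanZ m%:R); apply: Span_eqmod => i; rewrite scaler_nat.
exact: eqmod_refl.
Qed.

Lemma SpanMn_inv P m (X : term) : (0 < m)%N ->
  Span P (fun i => X i *+ m) -> Span P X.
Proof.
move=> m_gt0 /(SpanZ m%:R^-1); apply: Span_eqmod => i.
rewrite -scaler_nat scalerA mulVf ?scale1r; first exact: eqmod_refl.
by rewrite ((pcharf0P K).1 charK0) -lt0n.
Qed.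

Lemma Span_sum P (T : Type) (r : seq T) (X : T -> term) :
  (forall t, Span P (X t)) -> Span P (fun i => \sum_(t <- r) X t i).
Proof.
move=> PX; elim: r => [|t r IH].
  apply: Span_eqmod (Span0 P) => i; rewrite big_nil; exact: eqmod_refl.
apply: Span_eqmod (SpanD (PX t) IH) => i; rewrite big_cons; exact: eqmod_refl.
Qed.

Lemma Span_apick P (T : eqType) (F : forall i, T -> seq T -> B i) s :
  (forall y q, perm_eq (y :: q) s -> Span P (fun i => F i y q)) ->
  Span P (fun i => apick (F i) s).
Proof.
elim: s F => [|x r IH] F PF /=; first exact: Span0.
apply: SpanB; first exact: PF.
apply: (IH (fun i y q => F i y (x :: q))) => y q yq; exact/PF/perm_insert.
Qed.

Lemma Span_mword (P : mate -> Prop) π :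
  P π -> Span P (fun i => mword (z i) π (fixpts π)).
Proof.
move=> Pπ; exists (fun κ => (κ == π)%:R); split=> [κ|i].
  by have [->|] := eqVneq κ π; rewrite ?eqxx.
rewrite (bigD1 π) //= eqxx scale1r big1 ?addr0; first exact: eqmod_refl.
by move=> κ /negPf->; rewrite scale0r.
Qed.

Lemma Span_trans (P Q : mate -> Prop) X : Span P X ->
  (forall π, P π -> Span Q (fun i => mword (z i) π (fixpts π))) -> Span Q X.
Proof.
move=> [c [Pc Xc]] PQ; apply: Span_eqmod Xc _.
apply: (@Span_sum Q _ _ (fun π i => c π *: mword (z i) π (fixpts π))) => π.
have [c0|/Pc/PQ] := eqVneq (c π) 0; last exact: SpanZ.
by apply: Span_eqmod (Span0 Q) => i; rewrite c0 scale0r; apply: eqmod_refl.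
Qed.

Definition above (π κ : mate) : Prop := involutive κ /\ ltmate π κ.
Definition aboveeq (π κ : mate) : Prop := involutive κ /\ (κ = π \/ ltmate π κ).

Lemma mword_swap_span Q (π : mate) u p q v : involutive π ->
  perm_eq (u ++ p :: q :: v) (fixpts π) ->
  (forall κ, above π κ -> perm_eq (u ++ v) (fixpts κ) ->
    Span Q (fun i => mword (z i) κ (u ++ v))) ->
  Span Q (fun i => mword (z i) π (u ++ p :: q :: v) + mword (z i) π (u ++ q :: p :: v)).
Proof.
move=> iπ pu; have : uniq (p :: q :: u ++ v).
  by rewrite (perm_uniq (s2 := u ++ p :: q :: v)) ?(perm_uniq pu) ?uniq_fixpts //
    (perm_catCA [:: p; q] u).
rewrite /= inE negb_or -andbA => /andP[neq _].
have [fp fq] : π p = p /\ π q = q.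
  by split; apply/eqP; rewrite -mem_fixpts -(perm_mem pu) mem_cat !inE eqxx !orbT.
move=> QS; apply: Span_eqmod (QS (rematch π p q) _ _) => [i||].
- by apply: (mword_swap (idealJ i)).
- by split; [apply: rematch_invol|apply: rematch_gt].
apply: fixpts_rematch => //; apply: perm_trans pu.
by rewrite (perm_catCA [:: p; q] u v).
Qed.

(** Sorting by adjacent exchanges: each exchange changes the sign modulo a
    product with two letters less, attached to an involution above π. *)
Lemma mword_perm_span Q (π : mate) u v : involutive π ->
  perm_eq u (fixpts π) -> perm_eq u v ->
  (forall κ w, above π κ -> perm_eq w (fixpts κ) -> (size w < size u)%N ->
    Span Q (fun i => mword (z i) κ w)) ->
  Span Q (fun i => mword (z i) π u) -> Span Q (fun i => mword (z i) π v).
Proof.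
move=> iπ pu uv QS Qu.
pose R w := perm_eq u w -> Span Q (fun i => mword (z i) π w).
suff : R v by apply.
apply: (perm_swap_ind (Q := R)) uv _ => [w p q x Rpq pqp|_ //].
have ppq : perm_eq u (w ++ p :: q :: x).
  by apply: perm_trans pqp _; rewrite perm_cat2l (perm_catCA [:: q] [:: p]).
have S : Span Q (fun i => mword (z i) π (w ++ p :: q :: x)
                        + mword (z i) π (w ++ q :: p :: x)).
  apply: mword_swap_span => // [|κ aκ pκ].
    by apply: perm_trans pu; rewrite perm_sym.
  by apply: QS => //; rewrite (perm_size ppq) !size_cat /=; lia.
have := SpanB S (Rpq ppq); apply: Span_eqmod => i.
by rewrite [X in X - _]addrC addrK; apply: eqmod_refl.
Qed.

Lemma aboveeq_trans π κ ρ : above π κ -> aboveeq κ ρ -> above π ρ.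
Proof.
move=> [iκ lt] [iρ] [->|lt'] //; split=> //; exact: ltmate_trans lt lt'.
Qed.

Lemma mword_span (π : mate) u : involutive π -> perm_eq u (fixpts π) ->
  Span (aboveeq π) (fun i => mword (z i) π u).
Proof.
move: {2}(size u).+1 (ltnSn (size u)) => m.
elim: m π u => // m IH π u szu iπ pu.
have pu' : perm_eq (fixpts π) u by rewrite perm_sym.
apply: mword_perm_span (pu') _ _ => // [κ w aκ pw szw|].
  apply: Span_mono (IH κ w _ _ pw) => [ρ /(aboveeq_trans aκ)[iρ lt]||].
  - by split=> //; right.
  - by move: szw; rewrite -(perm_size pu); move: szu; rewrite !ltnS => h1 h2; lia.
  - by case: aκ.
by apply: Span_mword; split=> //; left.
Qed.

Lemma mword_above (π κ : mate) u : above π κ -> perm_eq u (fixpts κ) ->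
  Span (above π) (fun i => mword (z i) κ u).
Proof.
move=> aκ pu; apply: Span_mono (mword_span (proj1 aκ) pu) => ρ.
exact: aboveeq_trans.
Qed.

Lemma mword_swap_above (π : mate) u p q v : involutive π ->
  perm_eq (u ++ p :: q :: v) (fixpts π) ->
  Span (above π)
    (fun i => mword (z i) π (u ++ p :: q :: v) + mword (z i) π (u ++ q :: p :: v)).
Proof. by move=> iπ pu; apply: mword_swap_span => // κ aκ; apply: mword_above. Qed.

(** Bringing back to its place the letter that was picked costs exactly the
    sign with which it was picked, so all the terms are congruent to the same
    word. *)
Lemma pick_mword_span (π : mate) u s v : involutive π ->
  perm_eq (u ++ s ++ v) (fixpts π) ->
  Span (above π)
    (fun i => apick (fun y r => mword (z i) π (u ++ y :: r ++ v)) s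
              - mword (z i) π (u ++ s ++ v) *+ size s).
Proof.
move=> iπ; elim: s u => [|x s IH] u pu.
  apply: Span_eqmod (Span0 _) => i; rewrite mulr0n subr0; exact: eqmod_refl.
have pux : perm_eq (rcons u x ++ s ++ v) (fixpts π) by rewrite cat_rcons.
have S : Span (above π) (fun i => apick (fun y q =>
    mword (z i) π (u ++ y :: x :: q ++ v) + mword (z i) π (u ++ x :: y :: q ++ v)) s).
  apply: (Span_apick (F := fun i y q => mword (z i) π (u ++ y :: x :: q ++ v) +
      mword (z i) π (u ++ x :: y :: q ++ v))) => y q yq.
  apply: mword_swap_above => //; apply: perm_trans pu; rewrite perm_cat2l.
  by rewrite (perm_catCA [:: y] [:: x]) /= perm_cons -cat_cons perm_cat2r.
have := SpanB (IH _ pux) S; apply: Span_eqmod => i.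
rewrite apickD (eq_apick (F := fun y q => mword (z i) π (rcons u x ++ y :: q ++ v))
    (G := fun y q => mword (z i) π (u ++ x :: y :: q ++ v))) => [|y q _].
  rewrite cat_rcons mulrS /=.
  have e (V : zmodType) (a b c d : V) : a - b - (a + d) = c - d - (b + c).
    rewrite [a - b]addrC opprD addrA addrK [b + c]addrC opprD [RHS]addrA.
    by rewrite [c - d]addrC addrK addrC.
  rewrite (e _ _ _ (apick (fun y q => mword (z i) π (u ++ x :: y :: q ++ v)) s)).
  exact: eqmod_refl.
by rewrite cat_rcons.
Qed.


(** The standard polynomial is congruent to m! times the word of its letters,
    because all its terms are, with the sign of the permutation that sorts
    them. *)
Lemma std_span (π : mate) m u s v : involutive π -> size s = m ->
  perm_eq (u ++ s ++ v) (fixpts π) ->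
  Span (above π) (fun i =>
    mate_prod (z i) π * ((\prod_(p <- u) z i p) * (std (z i) m s * \prod_(p <- v) z i p))
    - mword (z i) π (u ++ s ++ v) *+ m`!).
Proof.
move=> iπ; elim: m u s => [|m IH] u s szs pu.
  apply: Span_eqmod (Span0 _) => i; move/size0nil: szs => ->.
  by rewrite /mword big_cat /= mul1r subrr; apply: eqmod_refl.
have S : Span (above π) (fun i => apick (fun y r =>
    mate_prod (z i) π * ((\prod_(p <- rcons u y) z i p) * (std (z i) m r * \prod_(p <- v) z i p))
    - mword (z i) π (rcons u y ++ r ++ v) *+ m`!) s).
  apply: (Span_apick (F := fun i y r => mate_prod (z i) π * ((\prod_(p <- rcons u y) z i p)
    * (std (z i) m r * \prod_(p <- v) z i p))
    - mword (z i) π (rcons u y ++ r ++ v) *+ m`!)) => y r yr.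
  apply: IH; first by have := perm_cons_size yr; rewrite szs => -[].
  by apply: perm_trans pu; rewrite cat_rcons perm_cat2l -cat_cons perm_cat2r.
have := SpanD S (SpanMn m`! (pick_mword_span iπ pu)); apply: Span_eqmod => i.
rewrite apickB -apickMn szs mulrnBl -mulrnA -factS addrA.
rewrite (eq_apick (F := fun y r => mword (z i) π (rcons u y ++ r ++ v))
  (G := fun y r => mword (z i) π (u ++ y :: r ++ v))) => [|y r _].
  rewrite subrK /= apickMr !apickMl.
  rewrite [X in eqmod _ _ (X - _)](eq_apick (G := fun y r => mate_prod (z i) π *
    ((\prod_(p <- u) z i p) * (z i y * std (z i) m r * \prod_(p <- v) z i p)))).
    exact: eqmod_refl.
  by move=> y r _; rewrite -cats1 big_cat big_seq1 !mulrA.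
by rewrite cat_rcons.
Qed.

(** What is retained of an involution κ reached from ρ by pairing the letters
    of ys with letters of s: the letters of s that are left over are not
    constrained. *)
Definition completes (ρ : mate) (ys s : seq 'I_n) (κ : mate) : Prop :=
  [/\ involutive κ, forall d, d \notin ys -> d \notin s -> κ d = ρ d
    & forall y, y \in ys -> κ y \in s].

Lemma pick_facts (ρ : mate) y ys s rest x r : involutive ρ ->
  perm_eq ((y :: ys) ++ s ++ rest) (fixpts ρ) -> perm_eq (x :: r) s ->
  [/\ ρ y = y, ρ x = x, y != x, involutive (rematch ρ y x)
    & perm_eq (ys ++ r ++ rest) (fixpts (rematch ρ y x))] /\
  [/\ y \notin ys, y \notin r, x \notin ys & x \notin r].
Proof.
move=> iρ pρ xr; have p2 : perm_eq (y :: x :: ys ++ r ++ rest) (fixpts ρ).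
  apply: perm_trans pρ; rewrite /= perm_cons -cat1s (perm_catCA [:: x] ys) perm_cat2l.
  by rewrite catA perm_cat2r.
have u2 : uniq (y :: x :: ys ++ r ++ rest) by rewrite (perm_uniq p2) uniq_fixpts.
have [fy fx] : ρ y = y /\ ρ x = x.
  by split; apply/eqP; rewrite -mem_fixpts -(perm_mem p2) !inE eqxx ?orbT.
move: u2; rewrite /= !inE !mem_cat !negb_or.
case/and3P=> /and4P[neq yys yr _] /and3P[xys xr' _] _.
split; split=> //; [exact: rematch_invol|exact: fixpts_rematch].
Qed.

Lemma paired_std_step i y ys (ρ : mate) s rest : involutive ρ ->
  perm_eq ((y :: ys) ++ s ++ rest) (fixpts ρ) ->
  eqmod (J i) (mate_prod (z i) ρ * (paired_std (z i) (y :: ys) s * \prod_(p <- rest) z i p))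
    (apick (fun x r => mate_prod (z i) (rematch ρ y x) *
      (paired_std (z i) ys r * \prod_(p <- rest) z i p)) s).
Proof.
move=> iρ pρ; rewrite /= apickMr apickMl.
apply: (eqmod_apick (idealJ i)) => x r xr.
have [[fy fx neq _ _] _] := pick_facts iρ pρ xr.
by rewrite -mulrA; apply: (mate_prod_absorb (idealJ i)).
Qed.

Lemma completes_rematch (ρ : mate) y ys s rest x r κ : involutive ρ ->
  perm_eq ((y :: ys) ++ s ++ rest) (fixpts ρ) -> perm_eq (x :: r) s ->
  completes (rematch ρ y x) ys r κ -> completes ρ (y :: ys) s κ /\ κ y = x.
Proof.
move=> iρ pρ xr [iκ κout κin].
have [[fy fx neq _ _] [yys yr xys xr']] := pick_facts iρ pρ xr.
have κy : κ y = x by rewrite κout // rematchl.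
split=> //; split=> // [d|d].
  rewrite inE negb_or => /andP[dy dys] ds.
  rewrite κout // ?rematchE //.
    by apply: contraNneq ds => ->; rewrite -(perm_mem xr) mem_head.
  by apply: contra ds => dr; rewrite -(perm_mem xr) inE dr orbT.
rewrite inE -(perm_mem xr) inE => /orP[/eqP->|/κin ->]; last by rewrite orbT.
by rewrite κy eqxx.
Qed.

Lemma paired_std_span ys (ρ : mate) s rest : involutive ρ ->
  perm_eq (ys ++ s ++ rest) (fixpts ρ) ->
  Span (fun κ => exists2 τ, completes ρ ys s τ & aboveeq τ κ)
    (fun i => mate_prod (z i) ρ * (paired_std (z i) ys s * \prod_(p <- rest) z i p)).
Proof.
elim: ys ρ s => [|y ys IH] ρ s iρ pρ.
  have leafρ : completes ρ [::] s ρ by [].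
  have S1 := std_span iρ (erefl (size s)) (pρ : perm_eq ([::] ++ s ++ rest) _).
  have S2 := SpanMn (size s)`! (mword_span iρ pρ).
  have S1' : Span (aboveeq ρ) _ :=
    Span_mono (fun κ h => conj (proj1 h) (or_intror (proj2 h))) S1.
  apply: Span_mono (_ : Span (aboveeq ρ) _); first by move=> κ aκ; exists ρ.
  have := SpanD S1' S2; apply: Span_eqmod => i.
  by rewrite subrK big_nil mul1r; apply: eqmod_refl.
apply: Span_eqmod (fun i => paired_std_step i iρ pρ) _.
apply: (Span_apick (F := fun i x r => mate_prod (z i) (rematch ρ y x) *
      (paired_std (z i) ys r * \prod_(p <- rest) z i p))) => x r xr.
have [[_ _ _ iρ' pρ'] _] := pick_facts iρ pρ xr.
apply: Span_mono (IH _ r iρ' pρ') => κ [τ leafτ τκ].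
by exists τ => //; have [] := completes_rematch iρ pρ xr leafτ.
Qed.

(** Here ys are the smaller elements of some 2-cycles of π and P is a set of
    fixed points, on which jointly y and π y increase; κ pairs the letters ys
    with other letters among their former partners and P.  At the first
    difference d between π and κ, both values are at least d, so that d is
    fixed by π or in ys.  In the latter case a smaller value κ d would also be
    the image under π, and hence under κ, of an index below d. *)
Lemma completes_above (π κ : mate) (ys P : seq 'I_n) : involutive π -> involutive κ ->
  (forall y y', y \in ys -> y' \in ys -> (π y < π y')%N -> (y < y')%N) ->
  (forall y p, y \in ys -> p \in P -> (p < π y)%N -> (p < y)%N) ->
  (forall p, p \in P -> π p = p) ->
  (forall d : 'I_n, (d < π d)%N -> d \notin ys -> κ d = π d) ->
  (forall y, y \in ys -> κ y \in [seq π y | y <- ys] ++ P) ->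
  κ != π -> above π κ.
Proof.
move=> iπ iκ chys chP fixP κout κin ne; split=> //.
rewrite eq_sym in ne; have [d hd ned] := first_diff ne; apply/ltmateP; exists d => //.
have ge1 := first_diff_ge iπ iκ hd ned.
have ge2 : (d <= κ d)%N.
  by apply: (first_diff_ge iκ iπ) => [e /hd //|]; rewrite eq_sym.
rewrite ltn_neqAle; rewrite -val_eqE in ned; rewrite ned /=.
have [πd|πd] := eqVneq (π d) d; first by rewrite πd.
have ltd : (d < π d)%N by rewrite ltn_neqAle eq_sym val_eqE πd (first_diff_ge iπ iκ hd).
have [dys|/(κout _ ltd) e] := boolP (d \in ys); last by rewrite e eqxx in ned.
rewrite leqNgt; apply/negP => lt.
have := κin _ dys; rewrite mem_cat => /orP[/mapP[y yys κd]|κdP].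
  rewrite κd in lt; have lty := chys _ _ yys dys lt.
  have := hd _ lty; rewrite -κd => /(congr1 κ); rewrite !iκ => yd.
  by rewrite yd ltnn in lty.
have lt2 := chP _ _ dys κdP lt.
have := hd _ lt2; rewrite iκ (fixP _ κdP) => e.
by rewrite e ltnn in lt2.
Qed.

(** Among the ways to pair ys with the letters of the sequence, the one that
    takes the first available letter each time gives back π; by
    [completes_above] all others give involutions above π.  The choice of the
    first letter is also the one picked with sign +1. *)
Lemma paired_std_lead_span (π : mate) (ys P : seq 'I_n) rest (ρ : mate) :
  involutive π -> involutive ρ ->
  perm_eq (ys ++ ([seq π y | y <- ys] ++ P) ++ rest) (fixpts ρ) ->
  (forall d, d \notin ys -> d \notin [seq π y | y <- ys] -> ρ d = π d) ->
  (forall y, y \in ys -> (y < π y)%N) ->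
  (forall y y', y \in ys -> y' \in ys -> (π y < π y')%N -> (y < y')%N) ->
  (forall y p, y \in ys -> p \in P -> (p < π y)%N -> (p < y)%N) ->
  (forall p, p \in P -> π p = p) ->
  Span (above π) (fun i =>
    mate_prod (z i) ρ * (paired_std (z i) ys ([seq π y | y <- ys] ++ P) * \prod_(p <- rest) z i p)
    - mate_prod (z i) π * (std (z i) (size P) P * \prod_(p <- rest) z i p)).
Proof.
move=> iπ; elim: ys ρ => [|y ys IH] ρ iρ pρ ρout up chys chP fixP.
  have -> : ρ = π by apply/ffunP => d; apply: ρout.
  by apply: Span_eqmod (Span0 _) => i; rewrite subrr; apply: eqmod_refl.
set s := [seq π y | y <- y :: ys] ++ P in pρ *.
set s' := [seq π y | y <- ys] ++ P.
have fs : perm_eq (π y :: s') s by [].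
have [[fy fx neq iρ1 pρ1] [yys _ _ xs']] := pick_facts iρ pρ fs.
have S1 : Span (above π) (fun i =>
    mate_prod (z i) (rematch ρ y (π y)) * (paired_std (z i) ys s' * \prod_(p <- rest) z i p)
    - mate_prod (z i) π * (std (z i) (size P) P * \prod_(p <- rest) z i p)).
  apply: IH => // [d dys dπys|y1 y1ys|y1 y2 y1ys y2ys|y1 p y1ys].
  - have [->|dy] := eqVneq d y; first by rewrite rematchl.
    have [->|dx] := eqVneq d (π y); first by rewrite rematchr // iπ.
    by rewrite rematchE // ρout ?inE // negb_or ?dy ?dx.
  - by apply: up; rewrite inE y1ys orbT.
  - by apply: chys; rewrite inE ?y1ys ?y2ys orbT.
  - by apply: chP; rewrite inE y1ys orbT.
have S2 : Span (above π) (fun i => apick (fun x r => mate_prod (z i) (rematch ρ y x) *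
      (paired_std (z i) ys (π y :: r) * \prod_(p <- rest) z i p)) s').
  apply: (Span_apick (F := fun i x r => mate_prod (z i) (rematch ρ y x) *
      (paired_std (z i) ys (π y :: r) * \prod_(p <- rest) z i p))) => x r xr.
  have xr2 : perm_eq (x :: π y :: r) s.
    by apply: perm_trans fs; rewrite (perm_catCA [:: x] [:: π y]) perm_cons.
  have [[_ _ _ iρ2 pρ2] _] := pick_facts iρ pρ xr2.
  apply: Span_mono (paired_std_span iρ2 pρ2) => κ [τ leafτ τκ].
  have [[iτ τout τin] τy] := completes_rematch iρ pρ xr2 leafτ.
  apply: aboveeq_trans τκ; apply: (@completes_above π τ (y :: ys) P) => //.
    move=> d ltd dys.
    have ds : d \notin s.
      rewrite mem_cat; apply/norP; split; last first.
        by apply: contraTN ltd => /fixP->; rewrite ltnn.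
      apply: contraTN ltd => /mapP[y1 y1ys ->]; rewrite iπ -leqNgt ltnW //.
      exact: up.
    rewrite τout // ρout //; apply: contra ds; rewrite mem_cat => ->; exact: orTb.
  apply: contraTneq xs' => τπ; rewrite negbK -τπ τy.
  by rewrite -(perm_mem xr) mem_head.
have := SpanB S1 S2; apply: Span_eqmod => i.
rewrite addrAC; apply: (eqmod_add (idealJ i)); last exact: eqmod_refl.
exact: (paired_std_step i iρ pρ).
Qed.

(** Unpair ys to get ρ.  The alternating sum over the letters of π ys and P,
    of which there are at least N, lies in the ideal; it is congruent to |P|!
    times the product attached to π modulo larger ones. *)
Lemma chain_span (π : mate) (ys P : seq 'I_n) : involutive π ->
  uniq (ys ++ P) -> (N <= size (ys ++ P))%N ->
  (forall y, y \in ys -> (y < π y)%N) ->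
  (forall y y', y \in ys -> y' \in ys -> (π y < π y')%N -> (y < y')%N) ->
  (forall y p, y \in ys -> p \in P -> (p < π y)%N -> (p < y)%N) ->
  (forall p, p \in P -> π p = p) ->
  Span (above π) (fun i => mword (z i) π (fixpts π)).
Proof.
move=> iπ; rewrite cat_uniq => /and3P[uys _ uP] szN up chys chP fixP.
pose πys := [seq π y | y <- ys].
pose ρ : mate := [ffun d => if (d \in ys) || (d \in πys) then d else π d].
have πysE d : (d \in πys) = (π d \in ys).
  by rewrite -{1}[d]iπ mem_map //; apply: inv_inj.
have iρ : involutive ρ.
  move=> d; rewrite [ρ d]ffunE; case: ifP => h; rewrite ffunE ?h //.
  by move: h; rewrite !πysE iπ orbC => ->.
have nys d : d \in ys -> π d != d.
  by move=> /up; rewrite ltn_neqAle eq_sym val_eqE => /andP[].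
pose rest := [seq p <- fixpts π | p \notin P].
have pP : perm_eq (P ++ rest) (fixpts π).
  apply: uniq_perm => [||d]; last 1 first.
  - rewrite mem_cat mem_filter; case: (boolP (d \in P)) => //= /fixP fd.
    by rewrite mem_fixpts fd eqxx.
  - rewrite cat_uniq uP filter_uniq ?uniq_fixpts // andbT.
    by apply/hasPn => d; rewrite mem_filter => /andP[].
  - exact: uniq_fixpts.
have pρ : perm_eq (ys ++ (πys ++ P) ++ rest) (fixpts ρ).
  rewrite -catA; apply: uniq_perm => [||d]; last 1 first.
  - rewrite !mem_cat mem_fixpts ffunE -mem_cat (perm_mem pP) mem_fixpts.
    by case: (d \in ys); case: (d \in πys); rewrite /= ?eqxx.
  - rewrite cat_uniq uys cat_uniq (map_inj_uniq (inv_inj iπ)) uys /=.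
    rewrite (perm_uniq pP) uniq_fixpts andbT; apply/andP; split.
      apply/hasPn => d; rewrite mem_cat (perm_mem pP) mem_fixpts.
      case/orP => [/mapP[y /up lt ->]|/eqP fd]; apply/negP => /up.
        by rewrite iπ ltnNge ltnW.
      by rewrite fd ltnn.
    apply/hasPn => d; rewrite (perm_mem pP) mem_fixpts => /eqP fd.
    by rewrite πysE fd; apply/negP => /up; rewrite fd ltnn.
  - exact: uniq_fixpts.
have S1 := paired_std_lead_span iπ iρ pρ.
have {}S1 := S1 _ up chys chP fixP.
have S2 := std_span iπ (erefl (size P)) (pP : perm_eq ([::] ++ P ++ rest) _).
have JH : Span (above π) (fun i =>
    mate_prod (z i) ρ * (paired_std (z i) ys (πys ++ P) * \prod_(p <- rest) z i p)).
  apply: Span_ideal => i; apply: (tsiMl (idealJ i)); apply: (tsiMr (idealJ i)).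
  apply: (paired_std_ideal (idealJ i) (comm_mod i) _ charK0 (stdJ i)).
  by move: szN; rewrite !size_cat size_map.
apply: (mword_perm_span iπ pP pP) => [κ w aκ pw _|]; first exact: mword_above.
apply: (SpanMn_inv (m := (size P)`!)); first exact: fact_gt0.
have S3 := SpanB JH (SpanD (S1 _) S2).
apply: Span_eqmod (S3 _) => [i|d dys dπys]; last first.
  by rewrite ffunE (negPf dys) (negPf dπys).
rewrite big_nil mul1r addrA subrK opprB addrC subrK; exact: eqmod_refl.
Qed.

End Spans.

(** * Chains and heights *)

Section Heights.
Variables (n : nat) (π : {ffun 'I_n -> 'I_n}).
Hypothesis iπ : involutive π.

(** The points (x, π x) for x in S form a chain of the plane for the strict
    product order.  Stated as an equality of the two comparisons, it is
    invariant under the exchange of the coordinates. *)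
Definition chainset (S : {set 'I_n}) : bool :=
  [forall x in S, forall y in S, (x < y)%N == (π x < π y)%N].

Definition chain_below (i : 'I_n) (S : {set 'I_n}) : bool :=
  chainset S && [forall x in S, (x < i)%N && (π x < π i)%N].

Definition height (i : 'I_n) : nat := \max_(S | chain_below i S) #|S|.

Lemma chainsetP (S : {set 'I_n}) :
  reflect {in S &, forall x y : 'I_n, (x < y)%N = (π x < π y)%N} (chainset S).
Proof.
apply: (iffP forall_inP) => [h x y xS yS|h x xS].
  by move/forall_inP: (h x xS) => /(_ y yS)/eqP.
by apply/forall_inP => y yS; apply/eqP; apply: h.
Qed.

Lemma chain_belowP (i : 'I_n) (S : {set 'I_n}) :
  reflect (chainset S /\ forall x : 'I_n, x \in S -> (x < i)%N /\ (π x < π i)%N)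
    (chain_below i S).
Proof.
apply: (iffP andP) => -[cS h]; split=> //.
  by move=> x xS; apply/andP; move/forall_inP: h; apply.
by apply/forall_inP => x xS; apply/andP; apply: h.
Qed.

Lemma card_le_height i S : chain_below i S -> (#|S| <= height i)%N.
Proof. exact: leq_bigmax_cond. Qed.

Lemma height_attained i : exists2 S, chain_below i S & #|S| = height i.
Proof.
have b0 : chain_below i set0.
  apply/chain_belowP; split; last by move=> x; rewrite inE.
  by apply/chainsetP => x; rewrite inE.
have [|S bS e] := @eq_bigmax_cond _ (chain_below i) (fun S => #|S|).
  by apply/card_gt0P; exists set0.
by exists S.
Qed.

Lemma height_mate i : height (π i) = height i.
Proof.
have le j : (height j <= height (π j))%N.
  have [S /chain_belowP[/chainsetP cS bS] <-] := height_attained j.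
  rewrite -(card_imset _ (inv_inj iπ)); apply: card_le_height.
  apply/chain_belowP; split.
    apply/chainsetP => _ _ /imsetP[x xS ->] /imsetP[y yS ->].
    by rewrite !iπ (cS x y).
  by move=> _ /imsetP[x xS ->]; rewrite !iπ; have [] := bS x xS.
by apply/eqP; rewrite eqn_leq le -{2}(iπ i) le.
Qed.

Lemma chain_below_add i S : chain_below i S -> chainset (i |: S) && (i \notin S).
Proof.
move=> /chain_belowP[/chainsetP cS bS]; apply/andP; split; last first.
  by apply/negP => /bS[]; rewrite ltnn.
apply/chainsetP => x y; rewrite !in_setU1.
case/predU1P=> [->|xS] /predU1P[->|yS]; last exact: cS.
- by rewrite !ltnn.
- by have [h1 h2] := bS y yS; rewrite !ltnNge (ltnW h1) (ltnW h2).
- by have [h1 h2] := bS x xS; rewrite h1 h2.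
Qed.

Lemma height_lt (i j : 'I_n) : (i < j)%N -> (π i < π j)%N -> (height i < height j)%N.
Proof.
move=> ij πij; have [S bS <-] := height_attained i.
have /andP[cS iS] := chain_below_add bS.
have -> : #|S|.+1 = #|i |: S| by rewrite cardsU1 iS.
apply: card_le_height; apply/chain_belowP; split=> // x.
rewrite in_setU1 => /predU1P[->//|xS]; have [_ /(_ x xS)[h1 h2]] := chain_belowP _ _ bS.
by split; [apply: ltn_trans ij|apply: ltn_trans πij].
Qed.

(** Replace each point (x, π x) of the chain by its reflection on or above the
    diagonal: minima and maxima of comparable pairs are still comparable.  No
    two points get identified, as (x, y) and (y, x) with x != y are not
    comparable. *)
Lemma chain_split (S : {set 'I_n}) : chainset S ->
  exists ys P : seq 'I_n, [/\ uniq (ys ++ P), size (ys ++ P) = #|S|,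
    forall y, y \in ys -> (y < π y)%N & forall p, p \in P -> π p = p] /\
  (forall y y', y \in ys ++ P -> y' \in ys ++ P -> (π y < π y')%N -> (y < y')%N).
Proof.
move=> /chainsetP cS.
pose lower (x : 'I_n) := if (x < π x)%N then x else π x.
have π_lower x : π (lower x) = if (x < π x)%N then π x else x.
  by rewrite /lower; case: ifP => //; rewrite iπ.
have lower_le x : (lower x <= π (lower x))%N.
  by rewrite π_lower /lower; case: ltnP => // /ltnW.
have lowerE : {in S &, forall x y : 'I_n,
    (lower x < lower y)%N = (π (lower x) < π (lower y))%N}.
  move=> x y xS yS; have h1 := cS _ _ xS yS; have h2 := cS _ _ yS xS.
  rewrite !π_lower /lower; move: h1 h2.
  by case: (ltnP x (π x)) => a; case: (ltnP y (π y)) => b; lia.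
have lower_inj : {in S &, injective lower}.
  move=> x y xS yS e; have h1 := cS _ _ xS yS; have h2 := cS _ _ yS xS.
  have e2 : π (lower x) = π (lower y) by rewrite e.
  move: e e2; rewrite !π_lower /lower => /(congr1 val) /= e /(congr1 val) /= e2.
  apply/val_inj => /=.
  move: e e2 h1 h2; case: (ltnP x (π x)) => a; case: (ltnP y (π y)) => b; lia.
pose L := lower @: S.
pose ys := [seq x <- enum L | ((x : 'I_n) < π x)%N].
pose P := [seq x <- enum L | ~~ ((x : 'I_n) < π x)%N].
exists ys, P.
have memL x : x \in ys ++ P -> x \in L.
  by rewrite mem_cat !mem_filter => /orP[] /and3P[].
split; last first.
  by move=> y y' /memL /imsetP[x xS ->] /memL /imsetP[x' x'S ->]; rewrite lowerE.
have pL := permEl (perm_filterC (fun x : 'I_n => (x < π x)%N) (enum L)).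
split.
- by rewrite (perm_uniq pL) enum_uniq.
- by rewrite (perm_size pL) -cardE card_in_imset.
- by move=> y; rewrite mem_filter => /andP[].
- move=> p; rewrite mem_filter mem_enum => /andP[np /imsetP[x xS e]].
  have lep : (p <= π p)%N by rewrite e.
  by apply/val_inj/eqP; rewrite eqn_leq lep andbT leqNgt.
Qed.

End Heights.

(** * Straightening and independence *)

Definition short_chains (k n : nat) (π : {ffun 'I_n -> 'I_n}) : bool :=
  [forall i, (height π i < k)%N].

Section Straightening.
Variables (K : fieldType) (Idx : Type) (B : Idx -> lalgType K).
Variables (J : forall i, B i -> Prop) (n : nat) (z : forall i, 'I_n -> B i).
Arguments J : clear implicits.
Hypothesis charK0 : [pchar K] =i pred0.
Hypothesis idealJ : forall i, two_sided_ideal (J i).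
Hypothesis comm_mod : forall i (x y l : 'I_n),
  eqmod (J i) (anticomm (z i) x y * z i l) (z i l * anticomm (z i) x y).
Variable k : nat.
Hypothesis stdJ : forall i s, size s = k.+1 -> J i (std (z i) k.+1 s).
Local Notation mate := {ffun 'I_n -> 'I_n}.

Lemma long_chain_span (π : mate) : involutive π -> ~~ short_chains k π ->
  Span J z (above π) (fun i => mword (z i) π (fixpts π)).
Proof.
move=> iπ; rewrite negb_forall => /existsP[i]; rewrite -leqNgt => le_k.
have [S bS eS] := height_attained π i.
have /andP[cS iS] := chain_below_add bS.
have [ys [P [[uniq_ sz up fixP] ch]]] := chain_split iπ cS.
apply: (chain_span charK0 idealJ comm_mod stdJ iπ uniq_ _ up _ _ fixP).
- by rewrite sz cardsU1 iS eS.
- by move=> y y' yys y'ys; apply: ch; rewrite mem_cat ?yys ?y'ys.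
- move=> y p yys pP lt; apply: ch; rewrite ?mem_cat ?yys ?pP ?orbT //.
  by rewrite (fixP p pP).
Qed.

(** Straightening replaces an involution by larger ones, and so it stops. *)
Lemma short_chains_span X : Span J z (fun π => involutive π) X ->
  Span J z (fun π => involutive π /\ short_chains k π) X.
Proof.
move=> S; apply: (Span_trans idealJ S) => π; move: {2}_.+1 (ltnSn #|[set κ | ltmate π κ]|) => m.
elim: m π => // m IH π lt_m iπ.
have [sc|nsc] := boolP (short_chains k π); first exact: Span_mword.
apply: (Span_trans idealJ (long_chain_span iπ nsc)) => κ [iκ lt].
apply: IH => //; rewrite ltnS in lt_m; apply: leq_trans lt_m.
apply: proper_card; apply/properP; split.
  by apply/subsetP => ρ; rewrite !inE; apply: ltmate_trans.
by exists κ; rewrite !inE ?lt // ltmate_irr.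
Qed.

(** A word with all letters is the product attached to the identity, where no
    index is paired. *)
Lemma perm_word_span (c : 'S_n -> K) :
  Span J z (fun π => involutive π /\ short_chains k π)
    (fun i => \sum_s c s *: \prod_p z i (s p)).
Proof.
apply: short_chains_span.
apply: (Span_sum idealJ _ (X := fun s i => c s *: \prod_p z i (s p))) => s.
apply: (SpanZ idealJ).
pose idm : mate := [ffun a => a].
have iid : involutive idm by move=> a; rewrite !ffunE.
have pid : perm_eq [seq s p | p <- enum 'I_n] (fixpts idm).
  apply: uniq_perm; rewrite ?uniq_fixpts // ?(map_inj_uniq perm_inj) ?enum_uniq //.
  move=> a; rewrite mem_fixpts ffunE eqxx; apply/mapP; exists ((s^-1)%g a).
    by rewrite mem_enum.
  by rewrite permKV.
have S := mword_span idealJ comm_mod iid pid.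
apply: Span_mono (_ : Span J z (aboveeq idm) _); first by move=> π [].
apply: (Span_eqmod idealJ) S => i.
rewrite /mword /mate_prod [X in eqmod _ _ (X * _)]big_pred0 => [|a]; last first.
  by rewrite ffunE ltnn.
rewrite mul1r big_map enumT; unlock index_enum; exact: (eqmod_refl (idealJ i)).
Qed.

End Straightening.

(** Two indices i < j of the same height satisfy π j < π i, by [height_lt].  At
    the first difference d, let κ d > π d.  The index κ d has the height of d,
    so its partner e in π is smaller than π d; having the height of d too,
    and a larger partner, e is smaller than d.  Then κ e = π e = κ d, a
    contradiction. *)
Lemma heights_rigid n (π κ : {ffun 'I_n -> 'I_n}) : involutive π -> involutive κ ->
  (forall a, height π (κ a) = height π a) -> ~~ ltmate π κ.
Proof.
move=> iπ iκ hκ; apply/negP => /ltmateP[d hd lt].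
have ned : π d != κ d by rewrite -val_eqE neq_ltn lt.
have ge1 := first_diff_ge iπ iκ hd ned.
have hq : height π (κ d) = height π d by [].
have ltq : (π (κ d) < π d)%N.
  rewrite ltnNge; apply/negP; rewrite leq_eqVlt => /orP[/eqP/val_inj/(inv_inj iπ) e|lt2].
    by move: lt; rewrite -e ltnNge ge1.
  have := height_lt (leq_ltn_trans ge1 lt) lt2.
  by rewrite hq ltnn.
set e := π (κ d) in ltq.
have he : height π e = height π d by rewrite height_mate.
have lte : (e < d)%N.
  rewrite ltnNge; apply/negP; rewrite leq_eqVlt => /orP[/eqP/val_inj ed|de].
    by move: lt; rewrite {1}ed /e iπ ltnn.
  have : (π d < π e)%N by rewrite /e iπ.
  by move=> /(height_lt de); rewrite he ltnn.
have := hd _ lte; rewrite {1}/e iπ => /(congr1 κ); rewrite !iκ => ed.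
by move: lte; rewrite -ed ltnn.
Qed.

Section Evaluation.
Variables (K : fieldType) (C : algType K) (k n : nat) (e : 'I_k -> C) (d : 'I_k -> K).
Hypothesis char2 : 2%:R != 0 :> K.
Hypothesis d_neq0 : forall i, d i != 0.
Hypothesis e_sqr : forall i, e i * e i = (d i)%:A.
Hypothesis e_anti : forall i j, i != j -> e i * e j + e j * e i = 0.
Local Notation mate := {ffun 'I_n -> 'I_n}.

(** Left invertible elements are nonzero and closed under products, which
    nonzero elements of C need not be. *)
Definition linv (x : C) : Prop := exists y, y * x = 1.

Lemma linv_neq0 x : linv x -> x != 0.
Proof.
by move=> [y yx]; apply/eqP => x0; move/eqP: yx; rewrite x0 mulr0 eq_sym oner_eq0.
Qed.

Lemma linvM x y : linv x -> linv y -> linv (x * y).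
Proof.
by move=> [x' xx] [y' yy]; exists (y' * x'); rewrite mulrA -(mulrA y') xx mulr1.
Qed.

Lemma linv_prod (T : Type) (r : seq T) (P : pred T) (F : T -> C) :
  (forall t, P t -> linv (F t)) -> linv (\prod_(t <- r | P t) F t).
Proof.
move=> LF; apply: big_ind => //; last exact: linvM.
by exists 1; rewrite mulr1.
Qed.

Lemma prod_zero_factor (T : eqType) (r : seq T) (P : pred T) (F : T -> C) t :
  t \in r -> P t -> F t = 0 -> \prod_(t <- r | P t) F t = 0.
Proof.
move=> tr Pt F0; elim: r tr => // t' r IH; rewrite inE big_cons.
case/predU1P=> [<-|/IH->]; first by rewrite Pt F0 mul0r.
by case: ifP; rewrite ?mulr0.
Qed.

Lemma linvA (a : K) : a != 0 -> linv a%:A.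
Proof. by move=> a0; exists (a^-1)%:A; rewrite -scalerAl mul1r scalerA mulVf ?scale1r. Qed.

Lemma mword_neq0 (c : 'I_n -> 'I_k) (π : mate) :
  (forall a, c (π a) = c a) -> mword (e \o c) π (fixpts π) != 0.
Proof.
move=> cπ; apply/linv_neq0/linvM; apply: linv_prod => a _.
  rewrite /anticomm /= cπ e_sqr -scalerDl; apply: linvA.
  by rewrite -mulr2n -mulr_natl mulf_neq0.
exists ((d (c a))^-1 *: e (c a)).
by rewrite -scalerAl /= e_sqr scalerA mulVf ?scale1r.
Qed.

Lemma mword_eq0 (c : 'I_n -> 'I_k) (π : mate) u : involutive π ->
  (exists a, c (π a) != c a) -> mword (e \o c) π u = 0.
Proof.
move=> iπ [a]; wlog lt : a / (a < π a)%N.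
  move=> th ne; have [lt|gt|/val_inj eq] := ltngtP a (π a).
  - exact: th lt ne.
  - by apply: (th (π a)); rewrite iπ // eq_sym.
  - by rewrite -eq eqxx in ne.
move=> ne; rewrite /mword /mate_prod (prod_zero_factor (t := a)) ?mul0r //.
by rewrite /anticomm /= e_anti // eq_sym.
Qed.

(** Induction along the lexicographic order.  Once the coefficients below π
    are zero, evaluating at the heights of π leaves only the term of π. *)
Lemma short_chains_independent (c : mate -> K) :
  (forall π, c π != 0 -> involutive π /\ short_chains k π) ->
  (forall col : 'I_n -> 'I_k,
    \sum_π c π *: mword (e \o col) π (fixpts π) = 0) ->
  forall π, c π = 0.
Proof.
move=> cP c0 π; move: {2}_.+1 (ltnSn #|[set κ | ltmate κ π]|) => m.
elim: m π => // m IH π lt_m; apply/eqP; apply: contraT => cπ.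
have [iπ /forallP hπ] := cP π cπ.
pose col a := Ordinal (hπ a).
have := c0 col; rewrite (bigD1 π) //= big1 ?addr0 => [/eqP|κ ne].
  rewrite scaler_eq0 (negPf cπ) (negPf (mword_neq0 _)) // => a.
  by apply: val_inj; rewrite /= height_mate.
have [->|cκ] := eqVneq (c κ) 0; first by rewrite scale0r.
have [iκ _] := cP κ cκ.
have [lt|lt] := ltmate_total ne.
  rewrite IH ?scale0r //; rewrite ltnS in lt_m; apply: leq_trans lt_m.
  apply: proper_card; apply/properP; split.
    by apply/subsetP => ρ; rewrite !inE => h; apply: ltmate_trans lt.
  by exists κ; rewrite !inE ?lt // ltmate_irr.
rewrite mword_eq0 ?scaler0 //; apply/existsP; apply: contraLR lt => nex.
apply: heights_rigid => // a; apply/eqP; apply: contraNT nex => h.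
by apply/existsP; exists a; rewrite -val_eqE.
Qed.

End Evaluation.

(** * Orthogonal bases *)

Lemma sym_form (K : fieldType) (V : vectType K) (b : {symmetric V}) u v : b u v = b v u.
Proof. by rewrite (hermC b) mul1r. Qed.

(** Extend an orthogonal family e of m < dim V anisotropic vectors.  Subtracting
    projections gives a nonzero w orthogonal to e and, by nondegeneracy, some y
    orthogonal to e with b w y != 0.  One of w, y and w + y is anisotropic. *)
Lemma orthogonal_basis (K : fieldType) (V : vectType K) (b : {symmetric V}) :
  2%:R != 0 :> K -> nondegenerate b ->
  exists e : 'I_(\dim {:V}) -> V,
    (forall i j, i != j -> b (e i) (e j) = 0) /\ (forall i, b (e i) (e i) != 0).
Proof.
move=> char2 nd.
suff [e [e0 e1]] : exists e : nat -> V,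
    (forall i j, (i < \dim {:V})%N -> (j < \dim {:V})%N -> i != j -> b (e i) (e j) = 0) /\
    (forall i, (i < \dim {:V})%N -> b (e i) (e i) != 0).
  by exists (fun i => e i); split=> [i j ij|i]; [apply: e0|apply: e1].
move: (leqnn (\dim {:V})); move: {1 3 4 5}(\dim {:V}) => m.
elim: m => [|m IH] lem; first by exists (fun=> 0).
have [e [e0 e1]] := IH (ltnW lem).
pose proj v := \sum_(i < m) (b v (e i) / b (e i) (e i)) *: e i.
have projP v i : (i < m)%N -> b (v - proj v) (e i) = 0.
  move=> im; rewrite linearBl /proj linear_sumlz /= (bigD1 (Ordinal im)) //= big1.
    by rewrite addr0 linearZl_LR /= divfK ?subrr // e1.
  by move=> j ji; rewrite linearZl_LR /= (e0 j i) ?mulr0 ?ltn_ord.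
have [v0 vS] : exists v0, v0 \notin <<[seq e i | i <- iota 0 m]>>%VS.
  have : ~~ (fullv <= <<[seq e i | i <- iota 0 m]>>)%VS.
    apply/negP => /dimvS; apply/negP; rewrite -ltnNge; apply: leq_trans lem.
    by rewrite ltnS (leq_trans (dim_span _)) // size_map size_iota.
  by case/subvPn => v1 _; exists v1.
set w := v0 - proj v0.
have w_neq0 : w != 0.
  apply: contraNneq vS => /eqP; rewrite subr_eq0 => /eqP->.
  apply: rpred_sum => i _; apply: rpredZ; apply: memv_span.
  by apply: map_f; rewrite mem_iota add0n ltn_ord.
have [x wx] : exists x, b w x != 0.
  have : w \notin orthov b fullv by rewrite (eqP nd) memv0.
  by case/mem_orthovPn => x _; exists x.
set y := x - proj x.
have wy : b w y != 0.
  rewrite linearBr /proj linear_sumr big1 ?subr0 // => i _.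
  by rewrite linearZr_LR /= projP ?mulr0.
have we i : (i < m)%N -> b w (e i) = 0 by move=> im; apply: projP.
have ye i : (i < m)%N -> b y (e i) = 0 by move=> im; apply: projP.
clearbody y w.
have [t [te tt]] : exists t, (forall i, (i < m)%N -> b t (e i) = 0) /\ b t t != 0.
  have [ww|ww] := eqVneq (b w w) 0; last by exists w.
  have [yy|yy] := eqVneq (b y y) 0; last by exists y.
  exists (w + y); split=> [i im|]; first by rewrite linearDl /= we // ye // addr0.
  rewrite linearDl /= !linearDr /= ww yy add0r addr0 (sym_form b y w).
  by rewrite -mulr2n -mulr_natl mulf_neq0.
exists (fun i => if i == m then t else e i); split=> [i j|i].
  rewrite !ltnS => im jm ij.
  have [ei|ni] := eqVneq i m; have [ej|nj] := eqVneq j m.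
  - by move: ij; rewrite ei ej eqxx.
  - by apply: te; rewrite ltn_neqAle nj.
  - by rewrite sym_form; apply: te; rewrite ltn_neqAle ni.
  - by apply: e0; rewrite // ltn_neqAle ?ni ?nj.
rewrite ltnS => im; have [//|ni] := eqVneq i m.
by apply: e1; rewrite ltn_neqAle ni.
Qed.

(** * Polarization *)

(** Expand the product over j of 1 + g j, where g j is 0 on A and -1 outside:
    its factors vanish outside A. *)
Lemma sum_sign_supersets (K : fieldType) n (A : {set 'I_n}) :
  \sum_(T : {set 'I_n})
    (\prod_j (if j \in T then 1 else -1)) * (A \subset T)%:R = (A == [set: 'I_n])%:R :> K.
Proof.
transitivity (\sum_(T in {set 'I_n})
    \prod_j (if j \in T then 1 else if j \in A then 0 else -1) : K).
  apply: eq_bigr => T _; have [AT|/subsetPn[a aA aT]] := boolP (A \subset T).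
    rewrite mulr1; apply: eq_bigr => j _; case: ifP => // jT.
    by case: ifP => // /(subsetP AT); rewrite jT.
  by rewrite mulr0 (bigD1 a) //= (negPf aT) aA mul0r.
rewrite -(bigA_distr _ _ (fun=> 1) (fun j : 'I_n => if j \in A then 0 else -1)).
have [->|] := eqVneq A setT.
  by rewrite big1 // => j _; rewrite inE /= addr0.
rewrite eqEsubset subsetT => /subsetPn[a _ aA].
by rewrite (bigD1 a) //= (negPf aA) /= subrr mul0r.
Qed.

Lemma prod_if (C : pzRingType) (I : finType) (A : pred I) (x : I -> C) :
  \prod_i (if A i then x i else 0) = if [forall i, A i] then \prod_i x i else 0.
Proof.
case: ifPn => [/forallP h|]; first by apply: eq_bigr => i _; rewrite h.
move=> /forallPn[a na]; have := mem_index_enum a.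
elim: (index_enum I) => // i r IH; rewrite inE big_cons => /predU1P[<-|/IH->].
  by rewrite (negPf na) mul0r.
by rewrite mulr0.
Qed.

Section Polarization.
Variables (K : fieldType) (C : algType K) (n : nat) (β : 'I_n -> nat) (u : 'I_n -> C).

Definition set_sign (T : {set 'I_n}) : K := \prod_j (if j \in T then 1 else -1).

Definition block_sum (T : {set 'I_n}) (i : nat) : C :=
  \sum_(j | (j \in T) && (β j == i)) u j.

(** Expanding the products gives all the ways φ to choose an index in the
    right block for each position; φ survives the signed sum over T if and only
    if it reaches all indices. *)
Lemma signed_block_sums m (w : 'I_m -> nat) :
  \sum_T set_sign T *: (\prod_(p < m) block_sum T (w p)) =
  \sum_(φ : {ffun 'I_m -> 'I_n} | ([set φ p | p : 'I_m] == [set: 'I_n]) &&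
    [forall p, β (φ p) == w p]) \prod_p u (φ p).
Proof.
have E T : \prod_(p < m) block_sum T (w p) =
    \sum_(φ : {ffun 'I_m -> 'I_n} | [forall p, β (φ p) == w p])
      ([set φ p | p : 'I_m] \subset T)%:R *: \prod_p u (φ p).
  rewrite /block_sum; under eq_bigr do rewrite big_mkcond /=.
  rewrite bigA_distr_bigA [RHS]big_mkcond; apply: eq_bigr => φ _.
  rewrite prod_if; have -> : [forall i, (φ i \in T) && (β (φ i) == w i)] =
      ([set φ p | p : 'I_m] \subset T) && [forall p, β (φ p) == w p].
    apply/forallP/andP => [h|[h1 /forallP h2] p].
      split; last by apply/forallP => p; case/andP: (h p).
      by apply/subsetP => _ /imsetP[p _ ->]; case/andP: (h p).
    by rewrite h2 (subsetP h1) // imset_f.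
  by case: (_ \subset _); case: [forall _, _] => //=; rewrite ?scale1r ?scale0r.
under eq_bigr do rewrite E scaler_sumr.
rewrite exchange_big /= [RHS]big_mkcondl; apply: eq_bigr => φ _.
under eq_bigr do rewrite scalerA.
rewrite -scaler_suml sum_sign_supersets.
by case: (_ == _); rewrite ?scale1r ?scale0r.
Qed.

Lemma signed_block_sums_small m (w : 'I_m -> nat) : (m < n)%N ->
  \sum_T set_sign T *: (\prod_(p < m) block_sum T (w p)) = 0.
Proof.
move=> mn; rewrite signed_block_sums big1 // => φ /andP[/eqP im _].
have := leq_imset_card φ 'I_m.
by rewrite im cardsT !card_ord leqNgt mn.
Qed.

Lemma signed_block_sums_perm (w : 'I_n -> nat) :
  \sum_T set_sign T *: (\prod_(p < n) block_sum T (w p)) =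
  \sum_(s : 'S_n | [forall p, β (s p) == w p]) \prod_p u (s p).
Proof.
have surj_inj (φ : {ffun 'I_n -> 'I_n}) :
    ([set φ p | p : 'I_n] == [set: 'I_n]) = injectiveb φ.
  apply/eqP/injectiveP => [im|inj]; last first.
    by apply/eqP; rewrite eqEcard subsetT cardsT card_imset /=.
  suff inj : {in 'I_n &, injective φ} by move=> a b; apply: inj.
  by apply/imset_injP; rewrite im cardsT.
rewrite signed_block_sums (reindex (fun s : 'S_n => pval s)) /=; last first.
  exists (insubd (1%g : perm_type _)) => [s _|φ]; first exact: valKd.
  by rewrite inE surj_inj => /andP[inj _]; rewrite insubdK.
apply: eq_big => [s|s _].
  rewrite surj_inj (valP s); apply: eq_forallb => p.
  by rewrite -pvalE.
by apply: eq_bigr => p _; rewrite pvalE.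
Qed.

Definition word (w : 'I_n -> nat) : {fmonom nat} := FMonom [seq w p | p <- enum 'I_n].

Lemma prod_word (A : pzRingType) (g : nat -> A) (w : 'I_n -> nat) :
  \prod_(i <- word w) g i = \prod_p g (w p).
Proof. by rewrite big_map enumT; unlock index_enum. Qed.

Lemma eq_word (w : {fmonom nat}) (v : 'I_n -> nat) : size w = n ->
  [forall p, v p == nth 0%N w p] = (w == word v).
Proof.
move=> szw; apply/forallP/eqP => [h|-> p]; last first.
  by rewrite (nth_map p) ?size_enum_ord // nth_ord_enum.
case: w szw h => w szw h; congr FMonom; apply: (@eq_from_nth _ 0%N) => [|i].
  by rewrite size_map size_enum_ord.
rewrite szw => lti; rewrite (nth_map (Ordinal lti)) ?size_enum_ord //.
by rewrite (nth_ord_enum _ (Ordinal lti)); apply/esym/eqP/(h (Ordinal lti)).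
Qed.

(** Words shorter than n admit no surjective choice of indices, and for words
    of length n surjective choices are permutations. *)
Lemma polarization (f : free_alg K) :
  (forall w : {fmonom nat}, w \in msupp f -> (size w <= n)%N) ->
  (forall T, feval (block_sum T) f = 0) ->
  \sum_(s : 'S_n) f@_(word (β \o s)) *: \prod_p u (s p) = 0.
Proof.
move=> szf f0; transitivity (\sum_T set_sign T *: feval (block_sum T) f); last first.
  by rewrite big1 // => T _; rewrite f0 scaler0.
rewrite /feval; under [RHS]eq_bigr do rewrite mmapE scaler_sumr.
rewrite exchange_big /=.
have E (w : {fmonom nat}) : w \in msupp f ->
   \sum_T set_sign T *: ((in_alg C f@_w) * \prod_(i <- w) block_sum T i) =
   \sum_(s : 'S_n) (w == word (β \o s))%:R *: (f@_w *: \prod_p u (s p)).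
  move=> /szf; rewrite leq_eqVlt => szw.
  transitivity (f@_w *: \sum_T set_sign T *: \prod_(p < size w) block_sum T (nth 0%N w p)).
    rewrite scaler_sumr; apply: eq_bigr => T _.
    rewrite mulr_algl !scalerA mulrC; congr (_ *: _).
    by rewrite (big_nth 0%N) big_mkord.
  case/predU1P: szw => [szw|lt].
    rewrite szw signed_block_sums_perm scaler_sumr big_mkcond /=.
    apply: eq_bigr => s _; rewrite -eq_word //.
    by case: ifP => _; rewrite ?scale1r ?scale0r.
  rewrite signed_block_sums_small // scaler0 big1 // => s _.
  case: eqP => [e|_]; last by rewrite scale0r.
  by move: lt; rewrite e size_map size_enum_ord ltnn.
rewrite [RHS]big_seq_cond.
under [RHS]eq_bigr => w do [rewrite andbT => wf; rewrite (E w wf)].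
rewrite -big_seq_cond exchange_big /=; apply: eq_bigr => s _.
have [wf|wf] := boolP (word (β \o s) \in msupp f).
  rewrite (bigD1_seq _ wf (fset_uniq _)) /=; case: eqP => // _.
  rewrite scale1r [X in _ + X]big1 ?addr0 //.
  by move=> w /negPf->; rewrite scale0r.
rewrite mcoeff_outdom // scale0r big_seq big1 // => w wf'.
by case: eqP => [e|_]; rewrite ?scale0r //; rewrite -e wf' in wf.
Qed.

End Polarization.

(** * Evaluation in the free algebra *)

Section FreeAlgebra.
Variable K : fieldType.
Local Notation F := (free_alg K).

Lemma word_cons (i : nat) (s : seq nat) :
  fvar K i * << FMonom s >> = << FMonom (i :: s) >>.
Proof.
rewrite /fvar malgM_def fgmulUU mulr1; congr << _ >>.
by apply/val_inj; rewrite /= fmM fmU.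
Qed.

Lemma prod_fvar (s : seq nat) : \prod_(i <- s) fvar K i = << FMonom s >>.
Proof.
elim: s => [|i s IH]; last by rewrite big_cons IH word_cons.
by rewrite big_nil; congr << _ >>; apply/val_inj; rewrite /= fm1.
Qed.

Lemma scale_monom (c : K) (w : {fmonom nat}) : c *: << w >> = << c *g w >> :> F.
Proof. by apply/malgP => v; rewrite mcoeffZ !mcoeffU mulr_natr. Qed.

Lemma feval_monom (R : lalgType K) (g : nat -> R) (c : K) (w : {fmonom nat}) :
  feval g (c *: << w >>) = c *: \prod_(i <- w) g i.
Proof. by rewrite scale_monom /feval mmapU mulr_algl. Qed.

Lemma feval_sum (R : lalgType K) (g : nat -> R) (I : Type) (r : seq I) (P : pred I)
    (h : I -> F) :
  feval g (\sum_(i <- r | P i) h i) = \sum_(i <- r | P i) feval g (h i).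
Proof. exact: raddf_sum. Qed.

Lemma fevalB (R : lalgType K) (g : nat -> R) (f h : F) :
  feval g (f - h) = feval g f - feval g h.
Proof. exact: raddfB. Qed.

Lemma feval_std (R : lalgType K) (g : nat -> R) m :
  feval g (std_poly K m) = \sum_(s : 'S_m) (-1) ^+ s * \prod_(i < m) g (s i).
Proof.
rewrite /std_poly feval_sum; apply: eq_bigr => s _.
rewrite (_ : \prod_(i < m) fvar K (s i) = << word (fun i => s i) >>).
  by rewrite feval_monom prod_word scaler_sign mulr_sign.
by rewrite -prod_fvar prod_word.
Qed.

Lemma feval_bracket (R : lalgType K) (g : nat -> R) :
  feval g (lie_bracket (fvar K 0 ^+ 2) (fvar K 1)) = lie_bracket (g 0%N ^+ 2) (g 1%N).
Proof.
have -> : lie_bracket (fvar K 0 ^+ 2) (fvar K 1) =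
    1 *: << FMonom [:: 0; 0; 1]%N >> - 1 *: << FMonom [:: 1; 0; 0]%N >>.
  by rewrite !scale1r -!prod_fvar !big_cons !big_nil !mulr1 /lie_bracket !mulrA.
rewrite fevalB !feval_monom !scale1r !big_cons !big_nil !mulr1.
by rewrite /lie_bracket !mulrA.
Qed.

Lemma in_spX_fvar i : in_spX (fvar K i).
Proof.
exists i.+1, (fun j => (j == i)%:R); rewrite big_ord_recr /= eqxx scale1r.
rewrite big1 ?add0r // => j _; have := ltn_ord j.
by rewrite ltn_neqAle => /andP[/negPf-> _]; rewrite scale0r.
Qed.

Lemma in_spXD i j : in_spX (fvar K i + fvar K j).
Proof.
have E l N : (l < N)%N -> fvar K l = \sum_(m < N) (val m == l)%:R *: fvar K m.
  move=> lN; rewrite (bigD1 (Ordinal lN)) //= eqxx scale1r big1 ?addr0 // => m.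
  by rewrite -val_eqE /= => /negPf->; rewrite scale0r.
exists (i + j).+1, (fun m => (m == i)%:R + (m == j)%:R).
rewrite (E i (i + j).+1) ?ltnS ?leq_addr // (E j (i + j).+1) ?ltnS ?leq_addl //.
by rewrite -big_split; apply: eq_bigr => m _; rewrite scalerDl.
Qed.

End FreeAlgebra.

(** * The theorem *)

Definition generators (K : fieldType) (k : nat) (h : free_alg K) : Prop :=
  h = lie_bracket (fvar K 0 ^+ 2) (fvar K 1) \/ h = std_poly K k.+1.

Section FreeSide.
Variables (K : fieldType) (k : nat) (J : free_alg K -> Prop).
Hypothesis idealJ : two_sided_ideal J.
Hypothesis genJ : forall h w, generators k h -> (forall j, in_spX (w j)) ->
  J (feval w h).
Variables (n : nat) (β : 'I_n -> nat).
Let z (j : 'I_n) : free_alg K := fvar K (β j).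

Lemma sqr_comm_ideal a i : in_spX a -> J (lie_bracket (a ^+ 2) (fvar K i)).
Proof.
move=> aX; rewrite -(feval_bracket (fun j => if j is 0%N then a else fvar K i)).
by apply: genJ; [left|case=> [|j] //; apply: in_spX_fvar].
Qed.

(** The polarization (a + b)^2 - a^2 - b^2 of the square is the
    anticommutator. *)
Lemma anticomm_central_ideal x y l :
  eqmod J (anticomm z x y * z l) (z l * anticomm z x y).
Proof.
have D (A : pzRingType) (a b c : A) :
    (a * b + b * a) * c - c * (a * b + b * a) =
    lie_bracket ((a + b) ^+ 2) c - lie_bracket (a ^+ 2) c - lie_bracket (b ^+ 2) c.
  have L (p q : A) : lie_bracket (p + q) c = lie_bracket p c + lie_bracket q c.
    by rewrite /lie_bracket mulrDl mulrDr opprD addrACA.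
  have -> : (a + b) ^+ 2 = a ^+ 2 + (a * b + b * a) + b ^+ 2.
    by rewrite !expr2 mulrDl !mulrDr !addrA.
  by rewrite !L addrAC addrK [lie_bracket (a ^+ 2) c + _]addrC addrK -L.
rewrite /eqmod /anticomm D; apply: idealB => //; first apply: idealB => //.
- by apply: sqr_comm_ideal; apply: in_spXD.
- by apply: sqr_comm_ideal; apply: in_spX_fvar.
- by apply: sqr_comm_ideal; apply: in_spX_fvar.
Qed.

Lemma std_free_ideal s : size s = k.+1 -> J (std z k.+1 s).
Proof.
case: s => // x0 r; set s := x0 :: r => szs.
have /(_ _) := @genJ (std_poly K k.+1) (fun j => z (nth x0 s j)).
move=> /(_ (or_intror erefl)) /(_ (fun j => in_spX_fvar K _)).
by rewrite feval_std -szs -(stdE x0).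
Qed.

End FreeSide.

Section CliffordSide.
Variables (K : fieldType) (V : vectType K) (b : {symmetric V}).
Variables (C : algType K) (iota : {linear V -> C}).
Hypothesis charK0 : [pchar K] =i pred0.
Hypothesis b_nondeg : nondegenerate b.
Hypothesis iota_sqr : forall v, iota v ^+ 2 = (b v v)%:A.
Let k := \dim {:V}.

Let natK m : (m%:R == 0 :> K) = (m == 0%N).
Proof. exact: (pcharf0P K).1. Qed.

Lemma clifford_anticomm u v :
  iota u * iota v + iota v * iota u = (b u v + b v u)%:A.
Proof.
have := iota_sqr (u + v); rewrite raddfD linearDl !linearDr /= !expr2.
rewrite mulrDl !mulrDr -!expr2 !iota_sqr !scalerDl.
by rewrite -!addrA => /addrI; rewrite !addrA => /addIr.
Qed.

(** Index the family of algebras by None for the free algebra and by the maps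
    from letters to basis vectors for the Clifford algebra.  The letters must go
    to basis vectors for S_(k+1) to vanish by mere repetition
    ([std_pigeonhole]). *)
Lemma multilinear_case (J : free_alg K -> Prop) n (c : 'S_n -> K) :
  two_sided_ideal J ->
  (forall h w, generators k h -> (forall j, in_spX (w j)) -> J (feval w h)) ->
  (forall u : 'I_n -> V, \sum_s c s *: \prod_p iota (u (s p)) = 0) ->
  forall β : 'I_n -> nat, J (\sum_s c s *: \prod_p fvar K (β (s p))).
Proof.
move=> idealJ genJ c0 β.
have char2 : 2%:R != 0 :> K by rewrite natK.
have [e [e_orth e_neq0]] := orthogonal_basis char2 b_nondeg.
pose E i := iota (e i).
have E_sqr i : E i * E i = (b (e i) (e i))%:A by rewrite -expr2 iota_sqr.
have E_anti i j : i != j -> E i * E j + E j * E i = 0.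
  by move=> ij; rewrite clifford_anticomm !e_orth ?addr0 ?scale0r // eq_sym.
pose Idx := option {ffun 'I_n -> 'I_k}.
pose B (i : Idx) : lalgType K := if i is Some _ then C : lalgType K else free_alg K.
pose I (i : Idx) : B i -> Prop :=
  match i return B i -> Prop with Some _ => fun x => x = 0 | None => J end.
pose z (i : Idx) : 'I_n -> B i :=
  match i return 'I_n -> B i with
  | Some col => fun j => E (col j) | None => fun j => fvar K (β j) end.
have idealI i : two_sided_ideal (I i).
  case: i => [col|] //; split=> //= [x y -> ->|x y ->|x y ->].
  - by rewrite addr0.
  - by rewrite mulr0.
  - by rewrite mul0r.
have commI i (x y l : 'I_n) :
    eqmod (I i) (anticomm (z i) x y * z i l) (z i l * anticomm (z i) x y).
  case: i => [col|]; last exact: (anticomm_central_ideal idealJ genJ).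
  rewrite /eqmod /I /anticomm /= clifford_anticomm.
  by rewrite -scalerAl -scalerAr mul1r mulr1 subrr.
have stdI i s : size s = k.+1 -> I i (std (z i) k.+1 s).
  case: i => [col|] szs; last exact: (std_free_ideal genJ).
  by have := @std_pigeonhole _ C _ _ col E s char2; rewrite szs; apply.
have [d [dP dE]] := perm_word_span charK0 idealI commI stdI c.
have d0 : forall π, d π = 0.
  apply: (short_chains_independent char2 (fun i => e_neq0 i) E_sqr E_anti dP) => col.
  have := dE (Some [ffun j => col j]); rewrite /eqmod /I /=.
  have -> : \sum_s c s *: \prod_p E ([ffun j => col j] (s p)) = 0.
    by apply: (c0 (fun j => e ([ffun j => col j] j))).
  rewrite sub0r => /eqP; rewrite oppr_eq0 => /eqP dcol; rewrite -[RHS]dcol.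
  apply: eq_bigr => π _; congr (_ *: _); rewrite /mword /mate_prod.
  congr (_ * _); apply: eq_bigr => a _ /=.
    by rewrite /anticomm /= !ffunE.
  by rewrite ffunE.
have := dE None; rewrite /eqmod /I /= [X in _ - X]big1 ?subr0 // => π _.
by rewrite d0 scale0r.
Qed.

End CliffordSide.

(** For each s, composition with s permutes the functions β. *)
Lemma sum_over_rearrangements (A : zmodType) (n : nat) (T : finType)
    (G : {ffun 'I_n -> T} -> A) :
  \sum_(β : {ffun 'I_n -> T}) \sum_(s : 'S_n) G [ffun p => β (s p)] =
  (\sum_β G β) *+ n`!.
Proof.
rewrite exchange_big /= -[n in n`!]card_ord -card_Sn ?card_ord -sumr_const.
apply: eq_bigr => s _.
rewrite [RHS](reindex (fun β : {ffun 'I_n -> T} => [ffun p => β (s p)])) //.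
exists (fun β : {ffun 'I_n -> T} => [ffun p => β ((s^-1)%g p)]) => β _.
  all: apply/ffunP => p; rewrite !ffunE.
  by rewrite permKV.
by rewrite permK.
Qed.

Section TopDegree.
Variables (K : fieldType) (V : vectType K) (b : {symmetric V}).
Variables (C : algType K) (iota : {linear V -> C}).
Hypothesis charK0 : [pchar K] =i pred0.
Hypothesis b_nondeg : nondegenerate b.
Hypothesis iota_sqr : forall v, iota v ^+ 2 = (b v v)%:A.
Variable J : free_alg K -> Prop.
Hypothesis idealJ : two_sided_ideal J.
Hypothesis genJ : forall h w, generators (\dim {:V}) h ->
  (forall j, in_spX (w j)) -> J (feval w h).
Local Notation weak := (weak_identity (fun c : C => exists v : V, c = iota v)).

Lemma weak_polarized n (f : free_alg K) (β : 'I_n -> nat) (u : 'I_n -> V) :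
  (forall w : {fmonom nat}, w \in msupp f -> (size w <= n)%N) -> weak f ->
  \sum_(s : 'S_n) f@_(word (β \o s)) *: \prod_p iota (u (s p)) = 0.
Proof.
move=> szf wf; apply: (polarization (u := iota \o u)) => // T; apply: wf => i.
by exists (\sum_(j | (j \in T) && (β j == i)) u j); rewrite raddf_sum.
Qed.

(** The component of degree n of f, when M exceeds the letters of its words:
    the functions from positions to letters below M enumerate those words once
    each. *)
Definition homog_part n M (f : free_alg K) : free_alg K :=
  \sum_(β : {ffun 'I_n -> 'I_M}) f@_(word (val \o β)) *: << word (val \o β) >>.

Lemma word_comp n M (β : {ffun 'I_n -> 'I_M}) (s : 'S_n) :
  word (val \o [ffun p => β (s p)]) = word ((val \o β) \o s).
Proof. by congr FMonom; apply: eq_map => p; rewrite /= ffunE. Qed.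

(** Instead of grouping words by their letters, whose stabilizers would give
    different factors, the sum over all words has the uniform factor n!. *)
Lemma homog_part_ideal n M f :
  (forall w : {fmonom nat}, w \in msupp f -> (size w <= n)%N) -> weak f ->
  J (homog_part n M f).
Proof.
move=> szf wf; have n_neq0 : n`!%:R != 0 :> K.
  by rewrite ((pcharf0P K).1 charK0) -lt0n fact_gt0.
rewrite -[homog_part _ _ _]scale1r -(mulVf n_neq0) -scalerA; apply: idealZ => //.
rewrite scaler_nat -sum_over_rearrangements.
apply: (big_ind J) => [||β _]; [exact: tsi0|exact: tsiD|].
under eq_bigr do rewrite word_comp.
have := multilinear_case charK0 b_nondeg iota_sqr idealJ genJ
  (fun u => weak_polarized (val \o β) u szf wf) (val \o β).
congr J; apply: eq_bigr => s _; congr (_ *: _).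
by rewrite -prod_fvar prod_word.
Qed.

Lemma homog_part_weak n M f :
  (forall w : {fmonom nat}, w \in msupp f -> (size w <= n)%N) -> weak f ->
  weak (homog_part n M f).
Proof.
move=> szf wf g gV; have n_neq0 : n`!%:R != 0 :> K.
  by rewrite ((pcharf0P K).1 charK0) -lt0n fact_gt0.
rewrite feval_sum; under eq_bigr do rewrite feval_monom.
apply/eqP; have := scaler_eq0 n`!%:R (\sum_(β : {ffun 'I_n -> 'I_M})
  f@_(word (val \o β)) *: \prod_(i <- word (val \o β)) g i).
rewrite (negPf n_neq0) orFb => <-.
rewrite scaler_nat -sum_over_rearrangements big1 // => β _.
have [v gv] : exists v : 'I_n -> V, forall p, g (val (β p)) = iota (v p).
  have /fin_all_exists[v gv] : forall p, exists v, g (val (β p)) = iota v by move=> p.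
  by exists v.
rewrite -[RHS](weak_polarized (val \o β) v szf wf); apply: eq_bigr => s _.
rewrite word_comp prod_word; congr (_ *: _); apply: eq_bigr => p _.
exact: gv.
Qed.

Lemma coeff_homog_part n M f (w : {fmonom nat}) : size w = n ->
  (f@_w != 0 -> forall i, i \in (w : seq nat) -> (i < M)%N) ->
  (homog_part n M f)@_w = f@_w.
Proof.
move=> szw wM; rewrite /homog_part raddf_sum /=.
have coefE (β : {ffun 'I_n -> 'I_M}) :
   (f@_(word (val \o β)) *: << word (val \o β) >> : free_alg K)@_w =
   f@_w *+ (word (val \o β) == w).
  by rewrite mcoeffZ mcoeffU mulr_natr; case: eqP => [->|].
under eq_bigr do rewrite coefE.
have [->|fw] := eqVneq f@_w 0; first by rewrite big1 // => β _; rewrite mul0rn.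
have wlt p : (nth 0%N w (val (p : 'I_n)) < M)%N.
  by apply: wM => //; rewrite mem_nth ?szw ?ltn_ord.
pose β0 := [ffun p : 'I_n => Ordinal (wlt p)].
have β0E : w = word (val \o β0).
  by apply/eqP; rewrite -eq_word //; apply/forallP => p; rewrite /= ffunE.
rewrite (bigD1 β0) //= -β0E eqxx [X in _ + X]big1 ?addr0 // => β ne.
case: eqP => // e; case/eqP: ne; apply/ffunP => p; apply: val_inj.
by move/esym/eqP: e; rewrite -eq_word // => /forallP/(_ p)/eqP /= ->; rewrite ffunE.
Qed.

Lemma weak_identity_ideal n (f : free_alg K) :
  (forall w : {fmonom nat}, w \in msupp f -> (size w < n)%N) -> weak f -> J f.
Proof.
elim: n f => [|n IH] f szf wf.
  suff -> : f = 0 by apply: tsi0.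
  by apply/malgP => w; rewrite mcoeff0; apply/eqP; rewrite mcoeff_eq0; apply/negP => /szf.
pose M := (\max_(w <- msupp f) \max_(i <- (w : seq nat)) i).+1.
have szf' w : w \in msupp f -> (size w <= n)%N by move/szf.
rewrite -[f](subrK (homog_part n M f)); apply: tsiD => //; last exact: homog_part_ideal.
apply: IH => [w|g gV]; last by rewrite fevalB wf // homog_part_weak ?subr0.
rewrite -mcoeff_neq0 mcoeffB; apply: contraR; rewrite -leqNgt => nw.
have [szw|szw] := eqVneq (size w) n; last first.
  rewrite mcoeff_outdom ?sub0r; last first.
    by apply/negP => /szf'; rewrite leqNgt ltn_neqAle eq_sym szw nw.
  rewrite oppr_eq0 /homog_part raddf_sum /= big1 // => β _.
  rewrite mcoeffZ mcoeffU; case: eqP => [e|_]; last by rewrite mulr0.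
  by move: szw; rewrite -e size_map size_enum_ord eqxx.
rewrite coeff_homog_part ?subrr // mcoeff_neq0 => wf' i iw.
have le_i : (i <= \max_(i <- (w : seq nat)) i)%N by apply: (leq_bigmax_seq (F := id) i).
rewrite ltnS; apply: leq_trans le_i _.
exact: (leq_bigmax_seq (F := fun w : {fmonom nat} => \max_(i <- (w : seq nat)) i)%N w).
Qed.

End TopDegree.

Theorem corollary1 (K : fieldType) (charK0 : [pchar K] =i pred0)
    (k : nat) (k_gt0 : (0 < k)%N)
    (V : vectType K) (dimV : \dim {:V} = k)
    (b : {symmetric V}) (b_nondeg : nondegenerate b)
    (C : algType K) (iota : {linear V -> C}) (clC : is_clifford b iota)
    (f : free_alg K) :
  weak_identity (fun c : C => exists v : V, c = iota v) f ->
  GL_ideal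
    (fun h : free_alg K =>
       h = lie_bracket (fvar K 0 ^+ 2) (fvar K 1) \/ h = std_poly K k.+1)
    f.
Proof.
move=> wf J idealJ genJ.
pose n := (\max_(w <- msupp f) size (w : seq nat)).+1.
apply: (weak_identity_ideal charK0 b_nondeg (clifford_sqr clC) idealJ _ (n := n)) wf.
  move=> h w gh wX; apply: genJ; exists h, w; split=> //.
  by rewrite -dimV.
move=> w wf; rewrite ltnS.
exact: (leq_bigmax_seq (F := fun w : {fmonom nat} => size (w : seq nat)) w).
Qed.
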